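(* For all generic values of $\tau, x_{\bar0}, x_1,\dots,x_L\in\mathbb C$, the partition function satisfies \[ M_0^{(\mathcal D)}\, Z_{\tau+\gamma}(X) + N_{\bar0}^{(\mathcal D)}\, Z_\tau(X) + \sum_{i=1}^{L} N_i^{(\mathcal D)}\, Z_{\tau}(X_i^{\bar0}) = 0 , \] where \[ M_0^{(\mathcal D)}=\prod_{j=1}^L[x_{\bar0}-\mu_j+\gamma],\qquad N_{\bar0}^{(\mathcal D)}=-\prod_{j=1}^L[x_{\bar0}-\mu_j]\prod_{j=1}^L\frac{[x_{\bar0}-x_j+\gamma]}{[x_{\bar0}-x_j]}, \] \[ N_i^{(\mathcal D)}=\frac{[\gamma]\,[\tau+(L+1)\gamma+x_{\bar0}-x_i]}{[x_{\bar0}-x_i]\,[\tau+(L+1)\gamma]}\prod_{j=1}^L[x_i-\mu_j]\prod_{\substack{j=1\\ j\ne i}}^L\frac{[x_i-x_j+\gamma]}{[x_i-x_j]}\qquad(1\le i\le L). \]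
   Context: Elliptic SOS setup. Fix $0<p<1$ and $\gamma\in\mathbb C$. For $x\in\mathbb C$ let $[x]:=\frac12\sum_{n\in\mathbb Z}(-1)^{n-\frac12}p^{(n+\frac12)^2}e^{-(2n+1)x}$ (the Jacobi theta function $\Theta_1(\mathrm i x,\nu)$, $p=e^{\mathrm i\pi\nu}$, in Whittaker–Watson conventions). Let $v_1,v_2$ be the standard basis of $\mathbb C^2$. The dynamical $R$-matrix $\mathcal R(x;\tau)\in\mathrm{End}(\mathbb C^2\otimes\mathbb C^2)$ is, in the ordered basis $v_1\otimes v_1, v_1\otimes v_2, v_2\otimes v_1, v_2\otimes v_2$, $\begin{pmatrix} a_+&0&0&0\\0&b_+&c_+&0\\0&c_-&b_-&0\\0&0&0&a_-\end{pmatrix}$ with $a_\pm=[x+\gamma]$, $b_\pm=[\tau\mp\gamma][x]/[\tau]$, $c_\pm=[\tau\mp x][\gamma]/[\tau]$. Fix $L\ge1$ and $\mu_1,\dots,\mu_L\in\mathbb C$. On $\mathbb C^2_0\otimes(\mathbb C^2)^{\otimes L}$ (auxiliary factor $0$, quantum factors $1,\dots,L$) let $h_k$ act on the $k$-th quantum factor by $h_kv_1=v_1$, $h_kv_2=-v_2$; $\mathcal R_{0i}(x;\tau-\gamma\sum_{k>i}h_k)$ denotes the operator acting on a tensor product of basis vectors whose $k$-th quantum factors have $h_k$-eigenvalues $\epsilon_k$ as $\mathcal R(x;\tau-\gamma\sum_{k>i}\epsilon_k)$ on factors $0,i$ and as identity elsewhere. The monodromy matrix is the ordered product $\mathcal T_0(x,\tau)=\mathcal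 R_{01}(x-\mu_1;\tau-\gamma\sum_{k=2}^Lh_k)\,\mathcal R_{02}(x-\mu_2;\tau-\gamma\sum_{k=3}^Lh_k)\cdots\mathcal R_{0L}(x-\mu_L;\tau)$, written as a $2\times2$ matrix in the auxiliary space (basis $v_1,v_2$) as $\begin{pmatrix}\mathcal A(x,\tau)&\mathcal B(x,\tau)\\ \mathcal C(x,\tau)&\mathcal D(x,\tau)\end{pmatrix}$ with entries in $\mathrm{End}((\mathbb C^2)^{\otimes L})$. Let $|0\rangle=v_1^{\otimes L}$ and $\langle\bar0|=(v_2^* )^{\otimes L}$ (dual basis covector). The partition function of the elliptic SOS model with domain-wall boundaries is $Z_\tau(x_1,\dots,x_L)=\langle\bar0|\mathcal B(x_1,\tau+\gamma)\mathcal B(x_2,\tau+2\gamma)\cdots\mathcal B(x_L,\tau+L\gamma)|0\rangle$. Notation: $X=(x_1,\dots,x_L)$; for an extra variable $x_\alpha$ and $1\le i\le L$, $X_i^\alpha$ is $X$ with $x_i$ replaced by $x_\alpha$. *)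

(* Defs.v *)
From Stdlib Require Import Reals List ZArith Bool ClassicalEpsilon.
Open Scope R_scope.

Record CC := mkCC { Re : R ; Im : R }.

Definition C0 : CC := mkCC 0 0.
Definition C1 : CC := mkCC 1 0.
Definition Ci : CC := mkCC 0 1.
Definition RtoC (r : R) : CC := mkCC r 0.
Definition Cadd (z w : CC) : CC := mkCC (Re z + Re w) (Im z + Im w).
Definition Copp (z : CC) : CC := mkCC (- Re z) (- Im z).
Definition Csub (z w : CC) : CC := Cadd z (Copp w).
Definition Cmul (z w : CC) : CC :=
  mkCC (Re z * Re w - Im z * Im w) (Re z * Im w + Im z * Re w).
Definition Cinv (z : CC) : CC :=
  mkCC (Re z / (Re z * Re z + Im z * Im z)) (- Im z / (Re z * Re z + Im z * Im z)).
Definition Cdiv (z w : CC) : CC := Cmul z (Cinv w).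
Definition Cexp (z : CC) : CC :=
  mkCC (exp (Re z) * cos (Im z)) (exp (Re z) * sin (Im z)).
Definition Cnat (n : nat) : CC := RtoC (INR n).
Definition CZ (m : Z) : CC := RtoC (IZR m).

Definition Csum (l : list CC) : CC := fold_right Cadd C0 l.
Definition Cprod (l : list CC) : CC := fold_right Cmul C1 l.

Definition Cseq_cv (u : nat -> CC) (l : CC) : Prop :=
  Un_cv (fun N => Re (u N)) (Re l) /\ Un_cv (fun N => Im (u N)) (Im l).

Definition Clim (u : nat -> CC) : CC :=
  epsilon (inhabits C0) (fun l => Cseq_cv u l).

(* n-th term  (-1)^(n-1/2) p^((n+1/2)^2) e^(-(2n+1)x), with the principal value
   (-1)^(n-1/2) = e^(i pi (n-1/2)) = -i (-1)^n. *)
Definition theta_term (p : R) (x : CC) (n : Z) : CC :=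
  Cmul (Cmul (Copp Ci) (RtoC (powerRZ (-1) n)))
       (Cmul (RtoC (Rpower p ((IZR n + /2) ^ 2)))
             (Cexp (Cmul (RtoC (- (2 * IZR n + 1))) x))).

Definition zrange (N : nat) : list Z :=
  map (fun k => (Z.of_nat k - Z.of_nat N)%Z) (seq 0 (2 * N + 1)).

(* [x] = 1/2 * sum_{n in Z} theta_term n  (symmetric partial sums; the series
   converges absolutely for 0 < p < 1) *)
Definition theta (p : R) (x : CC) : CC :=
  Clim (fun N => Cmul (RtoC (/2)) (Csum (map (theta_term p x) (zrange N)))).

(* Basis vectors: true = v1 (h = +1), false = v2 (h = -1).
   Rmat p g x tau ao qo ai qi = matrix element of R(x;tau) from input
   (aux ai) (x) (quantum qi) to output (aux ao) (x) (quantum qo). *)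
Definition Rmat (p : R) (g x tau : CC) (ao qo ai qi : bool) : CC :=
  let th := theta p in
  match ao, qo, ai, qi with
  | true, true, true, true => th (Cadd x g)
  | false, false, false, false => th (Cadd x g)
  | true, false, true, false => Cdiv (Cmul (th (Csub tau g)) (th x)) (th tau)
  | false, true, false, true => Cdiv (Cmul (th (Cadd tau g)) (th x)) (th tau)
  | true, false, false, true => Cdiv (Cmul (th (Csub tau x)) (th g)) (th tau)
  | false, true, true, false => Cdiv (Cmul (th (Cadd tau x)) (th g)) (th tau)
  | _, _, _, _ => C0
  end.

Definition heig (b : bool) : CC := if b then C1 else Copp C1.
Definition sum_h (s : list bool) : CC := Csum (map heig s).

(* Matrix element of the monodromy matrix
   R_01(x-mu_1; tau - g sum_{k>1} h_k) ... R_0n(x-mu_n; tau)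
   between auxiliary output ao / input ai and quantum output so / input si. *)
Fixpoint mono (p : R) (g x tau : CC) (mus : list CC) (ao : bool)
         (so si : list bool) (ai : bool) : CC :=
  match mus, so, si with
  | nil, nil, nil => if eqb ao ai then C1 else C0
  | mu :: mus', qo :: so', qi :: si' =>
      Csum (map (fun b =>
        Cmul (Rmat p g (Csub x mu) (Csub tau (Cmul g (sum_h so'))) ao qo b qi)
             (mono p g x tau mus' b so' si' ai)) (true :: false :: nil))
  | _, _, _ => C0
  end.

Fixpoint states (n : nat) : list (list bool) :=
  match n with
  | O => nil :: nil
  | S n' => map (cons true) (states n') ++ map (cons false) (states n')
  end.

Definition applyB (p : R) (g : CC) (mus : list CC) (x tau : CC)
           (v : list bool -> CC) : list bool -> CC :=
  fun so => Csum (map (fun si => Cmul (mono p g x tau mus true so si false) (v si))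
                      (states (length mus))).

Fixpoint applyBs (p : R) (g : CC) (mus : list CC) (tau : CC) (k : nat)
         (xs : list CC) (v : list bool -> CC) : list bool -> CC :=
  match xs with
  | nil => v
  | x :: xs' => applyB p g mus x (Cadd tau (Cmul (Cnat k) g))
                       (applyBs p g mus tau (S k) xs' v)
  end.

Definition list_eqb (s t : list bool) : bool :=
  if list_eq_dec bool_dec s t then true else false.

Definition Zpart (p : R) (g : CC) (L : nat) (mu : nat -> CC) (tau : CC)
           (x : nat -> CC) : CC :=
  let mus := map mu (seq 1 L) in
  let vac := fun s => if list_eqb s (repeat true L) then C1 else C0 in
  applyBs p g mus tau 1 (map x (seq 1 L)) vac (repeat false L).

Definition replace_at (x : nat -> CC) (i : nat) (xa : CC) : nat -> CC :=
  fun j => if Nat.eqb j i then xa else x j.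

Definition M0D (p : R) (g : CC) (L : nat) (mu : nat -> CC) (x0 : CC) : CC :=
  Cprod (map (fun j => theta p (Cadd (Csub x0 (mu j)) g)) (seq 1 L)).

Definition N0D (p : R) (g : CC) (L : nat) (mu : nat -> CC) (x0 : CC)
           (x : nat -> CC) : CC :=
  Copp (Cmul (Cprod (map (fun j => theta p (Csub x0 (mu j))) (seq 1 L)))
             (Cprod (map (fun j => Cdiv (theta p (Cadd (Csub x0 (x j)) g))
                                        (theta p (Csub x0 (x j)))) (seq 1 L)))).

Definition NiD (p : R) (g : CC) (L : nat) (mu : nat -> CC) (tau x0 : CC)
           (x : nat -> CC) (i : nat) : CC :=
  let tL := Cadd tau (Cmul (Cnat (L + 1)) g) in
  Cmul (Cdiv (Cmul (theta p g) (theta p (Cadd tL (Csub x0 (x i)))))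
             (Cmul (theta p (Csub x0 (x i))) (theta p tL)))
       (Cmul (Cprod (map (fun j => theta p (Csub (x i) (mu j))) (seq 1 L)))
             (Cprod (map (fun j => Cdiv (theta p (Cadd (Csub (x i) (x j)) g))
                                        (theta p (Csub (x i) (x j))))
                         (filter (fun j => negb (Nat.eqb j i)) (seq 1 L))))).

(* Main.v *)
(** The theta function satisfies an addition formula [x+y][x-y] = f(x)h(y) - h(x)f(y), obtained by
    substituting (s, d) = (n+m+1, n-m) in the double series; hence it is odd and satisfies the
    three-term relation.  The relation gives, by induction on the number of sites, the symmetry
    of B(x1,τ)B(x2,τ+γ) and of D(x1,τ)D(x2,τ+γ) and the rule for moving D through B.  Evaluating
    ⟨0̄|D(x0,τ+γ)B(x1,τ+2γ)...B(xL,τ+(L+1)γ)|0⟩ with D acting on ⟨0̄|, and again with D moved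
    through all the B's onto |0⟩, gives the two sides of the functional equation. *)

From Stdlib Require Import Reals List ZArith Lia Lra Bool Permutation FunctionalExtensionality ClassicalEpsilon Field.
Require Import Defs.
Open Scope R_scope.

(** B and D form the column of the monodromy matrix with auxiliary input v2. This column is closed
    under adding a site, so A and C never enter. Adding a site to a product of two such entries
    mixes D B with B D, B B and D D on the remaining sites; this is why the symmetries of B B and D
    D share one induction with the D B rule. The dynamical parameter depends on the state, but
    weight conservation gives it a single value on all intermediate states that contribute, so each
    comparison of coefficients is an identity between theta functions. Each such identity is an
    explicit linear combination of instances of the three-term relation.

    On the analytic side, [theta] is a chosen limit of symmetric partial sums, and (n, m) -> (n + m
    + 1, n - m) does not map squares to squares. Instead of rearranging an infinite double series,
    the proof compares a rotated finite square with an upright one and bounds the difference by the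
    part of a convergent geometric double sum that lies outside the smaller square. *)

Lemma CC_ext (z w : CC) : Re z = Re w -> Im z = Im w -> z = w.
Proof. destruct z, w; simpl; intros -> ->; reflexivity. Qed.

Lemma CC_ring : ring_theory C0 C1 Cadd Cmul Csub Copp (@eq CC).
Proof.
  constructor; intros; try reflexivity; apply CC_ext; simpl; ring.
Qed.

Lemma CC_field : field_theory C0 C1 Cadd Cmul Csub Copp Cdiv Cinv (@eq CC).
Proof.
  constructor; try reflexivity.
  - exact CC_ring.
  - intros H; injection H; lra.
  - intros [a b] Hz.
    assert (a * a + b * b <> 0).
    { intros H; apply Hz; apply CC_ext; simpl; nra. }
    apply CC_ext; simpl; field; exact H.
Qed.

Add Field CC_field_inst : CC_field.

Declare Scope CC_scope.
Delimit Scope CC_scope with CC.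
Infix "+" := Cadd : CC_scope.
Infix "-" := Csub : CC_scope.
Infix "*" := Cmul : CC_scope.
Infix "/" := Cdiv : CC_scope.
Notation "- x" := (Copp x) : CC_scope.
Local Open Scope CC_scope.

Lemma CC_integral (z w : CC) : z * w = C0 -> z = C0 \/ w = C0.
Proof.
  intros H. destruct (excluded_middle_informative (z = C0)) as [|Hz]; [now left|right].
  replace w with (Cinv z * (z * w)) by (field; exact Hz). rewrite H; ring.
Qed.

Lemma CC_sub_zero (z w : CC) : z - w = C0 -> z = w.
Proof. intros H. replace z with (z - w + w) by ring. rewrite H; ring. Qed.

Lemma Cmul_cancel_l (k z w : CC) : k <> C0 -> k * z = k * w -> z = w.
Proof.
  intros Hk H. replace z with (Cinv k * (k * z)) by (field; exact Hk). rewrite H; field; exact Hk.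
Qed.

Lemma Csum_app (l m : list CC) : Csum (l ++ m) = Csum l + Csum m.
Proof. induction l as [|z l IH]; simpl; [ring|]. rewrite IH; ring. Qed.

Lemma Csum_ext {T} (f h : T -> CC) (l : list T) :
  (forall t, In t l -> f t = h t) -> Csum (map f l) = Csum (map h l).
Proof. intros H; f_equal; apply map_ext_in; exact H. Qed.

Local Open Scope R_scope.

(** * The addition formula for theta *)

(** The l1 norm avoids square roots. It is subadditive and submultiplicative, and it bounds both
    coordinates, which is what [Cseq_cv] asks for. *)
Definition norm1 (z : CC) : R := Rabs (Re z) + Rabs (Im z).

Lemma norm1_pos (z : CC) : 0 <= norm1 z.
Proof. unfold norm1; pose proof (Rabs_pos (Re z)); pose proof (Rabs_pos (Im z)); lra. Qed.

Lemma norm1_add (z w : CC) : norm1 (z + w)%CC <= norm1 z + norm1 w.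
Proof.
  unfold norm1; simpl. pose proof (Rabs_triang (Re z) (Re w)). pose proof (Rabs_triang (Im z) (Im w)). lra.
Qed.

Lemma norm1_opp (z : CC) : norm1 (- z)%CC = norm1 z.
Proof. unfold norm1; simpl. rewrite !Rabs_Ropp. reflexivity. Qed.

Lemma norm1_mul (z w : CC) : norm1 (z * w)%CC <= norm1 z * norm1 w.
Proof.
  unfold norm1; simpl.
  pose proof (Rabs_triang (Re z * Re w) (- (Im z * Im w))) as H1.
  pose proof (Rabs_triang (Re z * Im w) (Im z * Re w)) as H2.
  rewrite Rabs_Ropp in H1. rewrite !Rabs_mult in *. unfold Rminus. lra.
Qed.

Definition Rsum (l : list R) : R := fold_right Rplus 0 l.

Lemma Rsum_app (l m : list R) : Rsum (l ++ m) = Rsum l + Rsum m.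
Proof. induction l as [|z l IH]; simpl; [lra|]. rewrite IH; lra. Qed.

Lemma Rsum_perm (l m : list R) : Permutation l m -> Rsum l = Rsum m.
Proof. induction 1; simpl; lra. Qed.

Lemma Csum_perm (l m : list CC) : Permutation l m -> Csum l = Csum m.
Proof.
  induction 1; simpl; [reflexivity|rewrite IHPermutation; reflexivity|ring|congruence].
Qed.

Lemma Rsum_le {T} (f h : T -> R) (l : list T) :
  (forall t, In t l -> f t <= h t) -> Rsum (map f l) <= Rsum (map h l).
Proof.
  induction l as [|t l IH]; intros H; simpl; [lra|].
  pose proof (H t (or_introl eq_refl)). pose proof (IH (fun s Hs => H s (or_intror Hs))). lra.
Qed.

Lemma norm1_Csum {T} (f : T -> CC) (l : list T) : norm1 (Csum (map f l)) <= Rsum (map (fun t => norm1 (f t)) l).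
Proof.
  induction l as [|t l IH]; simpl.
  - unfold norm1; simpl. rewrite Rabs_R0. lra.
  - pose proof (norm1_add (f t) (Csum (map f l))). lra.
Qed.

Lemma Re_Csum {T} (f : T -> CC) (l : list T) : Re (Csum (map f l)) = Rsum (map (fun t => Re (f t)) l).
Proof. induction l as [|t l IH]; simpl; [reflexivity|]. rewrite IH; reflexivity. Qed.

Lemma Im_Csum {T} (f : T -> CC) (l : list T) : Im (Csum (map f l)) = Rsum (map (fun t => Im (f t)) l).
Proof. induction l as [|t l IH]; simpl; [reflexivity|]. rewrite IH; reflexivity. Qed.

Lemma Rsum_prod {S T} (f : S -> R) (h : T -> R) (l : list S) (m : list T) :
  Rsum (map (fun z => f (fst z) * h (snd z)) (list_prod l m)) = Rsum (map f l) * Rsum (map h m).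
Proof.
  induction l as [|s l IH]; simpl; [ring|].
  rewrite map_app, Rsum_app, IH, map_map. simpl.
  assert (E : Rsum (map (fun t => f s * h t) m) = f s * Rsum (map h m)).
  { clear. induction m as [|t m IH]; simpl; [ring|]. rewrite IH; ring. }
  rewrite E; ring.
Qed.

Lemma Csum_prod {S T} (f : S -> CC) (h : T -> CC) (l : list S) (m : list T) :
  Csum (map (fun z => f (fst z) * h (snd z))%CC (list_prod l m)) = (Csum (map f l) * Csum (map h m))%CC.
Proof.
  induction l as [|s l IH]; simpl; [ring|].
  rewrite map_app, Csum_app, IH, map_map. simpl.
  assert (E : Csum (map (fun t => f s * h t)%CC m) = (f s * Csum (map h m))%CC).
  { clear. induction m as [|t m IH]; simpl; [ring|]. rewrite IH; ring. }
  rewrite E; ring.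
Qed.

(** * Sums over symmetric ranges of integers and their convergence *)

Lemma In_zrange (N : nat) (n : Z) : In n (zrange N) <-> (Z.abs n <= Z.of_nat N)%Z.
Proof.
  unfold zrange. rewrite in_map_iff. split.
  - intros [k [<- Hk]]. apply in_seq in Hk. lia.
  - intros H. exists (Z.to_nat (n + Z.of_nat N)). split; [lia|]. apply in_seq. lia.
Qed.

Lemma NoDup_zrange (N : nat) : NoDup (zrange N).
Proof.
  apply FinFun.Injective_map_NoDup; [|apply seq_NoDup]. intros a b H; cbv beta in H; lia.
Qed.

Lemma zrange_succ (N : nat) :
  Permutation (zrange (S N)) (Z.of_nat (S N) :: (- Z.of_nat (S N))%Z :: zrange N).
Proof.
  apply NoDup_Permutation.
  - apply NoDup_zrange.
  - constructor; [|constructor; [|apply NoDup_zrange]].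
    + intros [H|H]; [lia|]. apply In_zrange in H. lia.
    + intros H. apply In_zrange in H. lia.
  - intros n. cbn [In]. rewrite !In_zrange. lia.
Qed.

(** The weight e^(-|n|) is the common majorant: the Gaussian terms of all series lie below a
    multiple of it, and products of two such weights majorise the double sums. *)
Definition geo (n : Z) : R := exp (-1) ^ Z.abs_nat n.

Lemma exp_m1_bounds : 0 < exp (-1) < 1.
Proof. split; [apply exp_pos|]. rewrite <- exp_0. apply exp_increasing. lra. Qed.

Lemma geo_pos (n : Z) : 0 < geo n.
Proof. apply pow_lt, exp_m1_bounds. Qed.

Lemma geo_exp (n : Z) : geo n = exp (- IZR (Z.abs n)).
Proof.
  unfold geo. rewrite <- Zabs2Nat.id_abs, <- INR_IZR_INZ.
  induction (Z.abs_nat n) as [|k IH]; [simpl; rewrite Ropp_0, exp_0; reflexivity|].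
  rewrite S_INR. simpl. rewrite IH, <- exp_plus. f_equal; lra.
Qed.

Lemma geo_sum_bound (N : nat) : Rsum (map geo (zrange N)) <= 2 / (1 - exp (-1)).
Proof.
  pose proof exp_m1_bounds as Hq. set (q := exp (-1)) in *.
  (* The factor 1 - q keeps the induction free of division; the exact value of the left side is 1 +
     q - 2 q^(N+1). *)
  assert (H : Rsum (map geo (zrange N)) * (1 - q) <= 2 - 2 * q ^ (S N)).
  { induction N as [|N IH].
    - simpl. unfold geo; simpl. lra.
    - rewrite (Rsum_perm _ _ (Permutation_map geo (zrange_succ N))). cbn [map Rsum fold_right].
      fold (Rsum (map geo (zrange N))).
      assert (E1 : geo (Z.of_nat (S N)) = q ^ S N) by (unfold geo; f_equal; lia).
      assert (E2 : geo (- Z.of_nat (S N)) = q ^ S N) by (unfold geo; f_equal; lia).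
      rewrite E1, E2. replace (q ^ S (S N)) with (q * q ^ S N) by reflexivity. nra. }
  assert (0 < q ^ S N) by (apply pow_lt; lra).
  apply (Rmult_le_reg_r (1 - q)); [lra|].
  replace (2 / (1 - q) * (1 - q)) with 2 by (field; lra). lra.
Qed.

Lemma zsum_nonneg_cv (f : Z -> R) (K : R) :
  (forall n, 0 <= f n <= K * geo n) -> exists l, Un_cv (fun N => Rsum (map f (zrange N))) l.
Proof.
  intros Hf.
  assert (HK : 0 <= K).
  { pose proof (Hf 0%Z) as H0. unfold geo in H0; simpl in H0. lra. }
  destruct (growing_cv (fun N => Rsum (map f (zrange N)))) as [l Hl].
  - intros N. rewrite (Rsum_perm _ _ (Permutation_map f (zrange_succ N))). cbn [map Rsum fold_right].
    fold (Rsum (map f (zrange N))).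
    pose proof (Hf (Z.of_nat (S N))). pose proof (Hf (- Z.of_nat (S N))%Z). lra.
  - exists (K * (2 / (1 - exp (-1)))). intros z [N ->].
    apply Rle_trans with (Rsum (map (fun n => K * geo n) (zrange N))).
    + apply Rsum_le. intros; apply Hf.
    + assert (E : Rsum (map (fun n => K * geo n) (zrange N)) = K * Rsum (map geo (zrange N))).
      { induction (zrange N) as [|n l IH]; simpl; [ring|]. rewrite IH; ring. }
      rewrite E. apply Rmult_le_compat_l; [exact HK|apply geo_sum_bound].
  - exists l; exact Hl.
Qed.

(** Adding [K * geo n] makes all terms nonnegative, so that monotone convergence applies; the sum of
    the added terms is then subtracted. *)
Lemma zsum_cv (f : Z -> R) (K : R) :
  (forall n, Rabs (f n) <= K * geo n) -> exists l, Un_cv (fun N => Rsum (map f (zrange N))) l.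
Proof.
  intros Hf.
  destruct (zsum_nonneg_cv (fun n => f n + K * geo n) (2 * K)) as [l1 H1].
  { intros n. pose proof (Hf n) as H. pose proof (Rle_abs (f n)). pose proof (Rle_abs (- f n)) as H'.
    rewrite Rabs_Ropp in H'. lra. }
  destruct (zsum_nonneg_cv (fun n => K * geo n) K) as [l2 H2].
  { intros n. pose proof (Hf n). pose proof (Rabs_pos (f n)). lra. }
  exists (l1 - l2). pose proof (CV_minus _ _ _ _ H1 H2) as H.
  intros eps He. destruct (H eps He) as [N0 HN]. exists N0. intros N HN'.
  replace (Rsum (map f (zrange N))) with
    (Rsum (map (fun n => f n + K * geo n) (zrange N)) - Rsum (map (fun n => K * geo n) (zrange N))).
  - apply HN; exact HN'.
  - induction (zrange N) as [|n l IH]; simpl; [ring|]. rewrite <- IH. ring.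
Qed.

Definition dominated (f : Z -> CC) : Prop := exists K, forall n, norm1 (f n) <= K * geo n.

Lemma dominated_cv (f : Z -> CC) : dominated f ->
  exists l, Cseq_cv (fun N => Csum (map f (zrange N))) l.
Proof.
  intros [K HK].
  destruct (zsum_cv (fun n => Re (f n)) K) as [a Ha].
  { intros n. specialize (HK n). unfold norm1 in HK. pose proof (Rabs_pos (Im (f n))). lra. }
  destruct (zsum_cv (fun n => Im (f n)) K) as [b Hb].
  { intros n. specialize (HK n). unfold norm1 in HK. pose proof (Rabs_pos (Re (f n))). lra. }
  exists (mkCC a b). split; simpl.
  - intros eps He. destruct (Ha eps He) as [N0 HN]. exists N0. intros N HN'. rewrite Re_Csum. auto.
  - intros eps He. destruct (Hb eps He) as [N0 HN]. exists N0. intros N HN'. rewrite Im_Csum. auto.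
Qed.

Lemma Cseq_cv_unique (u : nat -> CC) (l l' : CC) : Cseq_cv u l -> Cseq_cv u l' -> l = l'.
Proof. intros [H1 H2] [H3 H4]. apply CC_ext; eapply UL_sequence; eassumption. Qed.

(** [Clim] picks some limit by choice, and uniqueness of limits identifies it with the given one. *)
Lemma Clim_eq (u : nat -> CC) (l : CC) : Cseq_cv u l -> Clim u = l.
Proof.
  intros H. apply (Cseq_cv_unique u); [|exact H].
  unfold Clim. apply (epsilon_spec (inhabits C0) (fun l => Cseq_cv u l)). exists l; exact H.
Qed.

Lemma Cseq_cv_mul (u w : nat -> CC) (l m : CC) :
  Cseq_cv u l -> Cseq_cv w m -> Cseq_cv (fun N => u N * w N)%CC (l * m)%CC.
Proof.
  intros [H1 H2] [H3 H4]. split; simpl.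
  - apply CV_minus; apply CV_mult; assumption.
  - apply CV_plus; apply CV_mult; assumption.
Qed.

Lemma Cseq_cv_sub (u w : nat -> CC) (l m : CC) :
  Cseq_cv u l -> Cseq_cv w m -> Cseq_cv (fun N => u N - w N)%CC (l - m)%CC.
Proof.
  intros [H1 H2] [H3 H4]. split; simpl; apply CV_plus; auto; apply CV_opp; assumption.
Qed.

Lemma Cseq_cv_const (c : CC) : Cseq_cv (fun _ => c) c.
Proof. split; intros eps He; exists 0%nat; intros; rewrite Rdist_eq; exact He. Qed.

Lemma Un_cv_subseq (u : nat -> R) (phi : nat -> nat) (l : R) :
  (forall n, (n <= phi n)%nat) -> Un_cv u l -> Un_cv (fun n => u (phi n)) l.
Proof.
  intros Hphi H eps He. destruct (H eps He) as [N0 HN]. exists N0. intros n Hn. apply HN.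
  specialize (Hphi n). lia.
Qed.

Lemma Cseq_cv_squeeze (u w : nat -> CC) (e : nat -> R) (l m : CC) :
  Cseq_cv u l -> Cseq_cv w m -> (forall N, norm1 (u N - w N)%CC <= e N) -> Un_cv e 0 -> l = m.
Proof.
  intros Hu Hw He H0.
  assert (Hd : Cseq_cv (fun N => u N - w N)%CC C0).
  { split; intros eps Heps; destruct (H0 eps Heps) as [N0 HN]; exists N0; intros n Hn;
      specialize (HN n Hn); specialize (He n); unfold norm1 in He; unfold Rdist in *; simpl in *;
      rewrite Rminus_0_r in *;
      [pose proof (Rabs_pos (Im (u n) + - Im (w n)))|pose proof (Rabs_pos (Re (u n) + - Re (w n)))];
      pose proof (Rle_abs (e n)); lra. }
  pose proof (Cseq_cv_unique _ _ _ Hd (Cseq_cv_sub _ _ _ _ Hu Hw)) as E.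
  transitivity (l - m + m)%CC; [ring|]. rewrite <- E. ring.
Qed.

(** Exhibits the complement of a duplicate-free sublist, so that a difference of two finite sums
    becomes a single sum over [r]. *)
Lemma NoDup_incl_perm {T} (l1 l2 : list T) :
  NoDup l1 -> incl l1 l2 -> exists r, Permutation l2 (l1 ++ r).
Proof.
  revert l2; induction l1 as [|a l1 IH]; intros l2 Hnd Hincl; [exists l2; reflexivity|].
  inversion Hnd; subst.
  destruct (in_split a l2) as [m1 [m2 ->]]; [apply Hincl; now left|].
  destruct (IH (m1 ++ m2)) as [r Hr]; [assumption| |].
  - intros b Hb. assert (Hb' : In b (m1 ++ a :: m2)) by (apply Hincl; now right).
    apply in_app_iff in Hb'. apply in_app_iff. destruct Hb' as [|[->|]]; auto. contradiction.
  - exists r. rewrite <- Permutation_middle. simpl. constructor. exact Hr.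
Qed.

Lemma NoDup_list_prod {S T} (l : list S) (m : list T) : NoDup l -> NoDup m -> NoDup (list_prod l m).
Proof.
  intros Hl Hm. induction Hl as [|s l Hs Hl IH]; simpl; [constructor|].
  apply NoDup_app; auto.
  - apply FinFun.Injective_map_NoDup; [intros a b H; congruence|exact Hm].
  - intros [s' t] H1 H2. apply in_map_iff in H1. destruct H1 as [t' [E _]]. injection E as <- _.
    apply in_prod_iff in H2. tauto.
Qed.

(** * Squares and rotated squares of index pairs *)

Definition box (N : nat) : list (Z * Z) := list_prod (zrange N) (zrange N).
(* (n, m) to (n + m + 1, n - m): the exponents of e^(-2x) and e^(-2y) in the product of
   term n at x + y with term m at x - y. *)
Definition rot (z : Z * Z) : Z * Z := ((fst z + snd z + 1)%Z, (fst z - snd z)%Z).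

Lemma In_box (N : nat) (s d : Z) : In (s, d) (box N) <-> (Z.abs s <= Z.of_nat N /\ Z.abs d <= Z.of_nat N)%Z.
Proof. unfold box. rewrite in_prod_iff, !In_zrange. tauto. Qed.

Lemma NoDup_box (N : nat) : NoDup (box N).
Proof. apply NoDup_list_prod; apply NoDup_zrange. Qed.

(* The rotated box of size M + 1 contains the points of [box M] with s + d odd and lies in
   [box (2 * M + 3)], so the difference is bounded by the sum over the annulus. *)
Lemma box_compare (w : Z * Z -> CC) (K : R) (M : nat) :
  (forall s d, Z.even (s + d) = true -> w (s, d) = C0) ->
  (forall z, norm1 (w z) <= K * (geo (fst z) * geo (snd z))) ->
  norm1 (Csum (map w (map rot (box (S M)))) - Csum (map w (box M)))%CC
  <= K * (Rsum (map geo (zrange (2 * M + 3))) * Rsum (map geo (zrange (2 * M + 3)))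
          - Rsum (map geo (zrange M)) * Rsum (map geo (zrange M))).
Proof.
  intros Hw HK.
  set (odd := fun z : Z * Z => negb (Z.even (fst z + snd z))).
  set (l1 := filter odd (box M)). set (l2 := map rot (box (S M))).
  assert (Hl2 : forall s d, In (s, d) l2 -> odd (s, d) = true /\ In (s, d) (box (2 * M + 3))).
  { intros s d H. apply in_map_iff in H. destruct H as [[n m] [E H]]. unfold rot in E; simpl in E.
    apply In_box in H. injection E as <- <-. split.
    - unfold odd; simpl. replace (n + m + 1 + (n - m))%Z with (1 + 2 * n)%Z by lia.
      rewrite Z.even_add_mul_2. reflexivity.
    - apply In_box. lia. }
  assert (E1 : Csum (map w (box M)) = Csum (map w l1)).
  { unfold l1. induction (box M) as [|[s d] l IH]; simpl; [reflexivity|].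
    destruct (odd (s, d)) eqn:E; simpl; rewrite IH; [reflexivity|].
    rewrite Hw; [ring|]. unfold odd in E; simpl in E. destruct (Z.even (s + d)); [reflexivity|discriminate]. }
  (* [r] is what the rotated square has beyond the odd points of [box M]. *)
  destruct (NoDup_incl_perm l1 l2) as [r Hr].
  { apply NoDup_filter, NoDup_box. }
  { intros [s d] H. apply filter_In in H. destruct H as [H Ho]. apply In_box in H.
    unfold odd in Ho; simpl in Ho. rewrite Z.negb_even in Ho. apply Z.odd_spec in Ho. destruct Ho as [k Hk].
    (* The inverse of [rot]: n = (s + d - 1) / 2 and m = (s - d - 1) / 2 = s - 1 - n. *)
    apply in_map_iff. exists (k, (s - 1 - k)%Z). split.
    - unfold rot; simpl. f_equal; lia.
    - apply In_box. lia. }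
  assert (Hndr : NoDup (l1 ++ r)).
  { eapply Permutation_NoDup; [exact Hr|]. apply FinFun.Injective_map_NoDup; [|apply NoDup_box].
    intros [a b] [c d] H. unfold rot in H; simpl in H. injection H as H1 H2. f_equal; lia. }
  assert (Hr2 : forall s d, In (s, d) r -> In (s, d) (box (2 * M + 3)) /\ ~ In (s, d) (box M)).
  { intros s d H.
    assert (H2 : In (s, d) l2) by (eapply Permutation_in; [symmetry; exact Hr|]; apply in_app_iff; auto).
    destruct (Hl2 _ _ H2) as [Ho Hb]. split; [exact Hb|]. intros Hc.
    (* A point of [r] inside [box M] is odd, hence already in [l1], against the absence of
       duplicates. *)
    apply in_split in H. destruct H as [r1 [r2 ->]].
    rewrite app_assoc in Hndr. apply NoDup_remove_2 in Hndr. apply Hndr.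
    rewrite !in_app_iff. left; left. apply filter_In. auto. }
  assert (HK0 : 0 <= K).
  { pose proof (HK (0, 0)%Z) as H. pose proof (norm1_pos (w (0, 0)%Z)). unfold geo in H; simpl in H. lra. }
  set (h := fun z : Z * Z => (K * geo (fst z)) * geo (snd z)).
  assert (Hh : forall z, 0 <= h z).
  { intros z. unfold h. pose proof (geo_pos (fst z)). pose proof (geo_pos (snd z)).
    apply Rmult_le_pos; [apply Rmult_le_pos|]; lra. }
  assert (Hbox : forall N, Rsum (map h (box N)) = K * (Rsum (map geo (zrange N)) * Rsum (map geo (zrange N)))).
  { intros N. unfold h, box. rewrite (Rsum_prod (fun s => K * geo s) geo).
    replace (Rsum (map (fun s => K * geo s) (zrange N))) with (K * Rsum (map geo (zrange N))); [ring|].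
    induction (zrange N) as [|n l IH]; simpl; [ring|]. rewrite <- IH; ring. }
  destruct (NoDup_incl_perm (box M ++ r) (box (2 * M + 3))) as [r' Hr'].
  { apply NoDup_app; [apply NoDup_box|eapply NoDup_app_remove_l; exact Hndr|].
    intros [s d] H1 H2. exact (proj2 (Hr2 _ _ H2) H1). }
  { intros [s d] H. apply in_app_iff in H. destruct H as [H|H].
    - apply In_box in H. apply In_box. lia.
    - exact (proj1 (Hr2 _ _ H)). }
  rewrite E1, (Csum_perm _ _ (Permutation_map w Hr)), map_app, Csum_app.
  replace (Csum (map w l1) + Csum (map w r) - Csum (map w l1))%CC with (Csum (map w r)) by ring.
  apply Rle_trans with (Rsum (map h r)).
  - apply Rle_trans with (1 := norm1_Csum w r). apply Rsum_le. intros z _.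
    unfold h. rewrite Rmult_assoc. apply HK.
  - rewrite Rmult_minus_distr_l, <- !Hbox.
    rewrite (Rsum_perm _ _ (Permutation_map h Hr')), !map_app, !Rsum_app.
    assert (0 <= Rsum (map h r')).
    { clear -Hh. induction r' as [|z l IH]; simpl; [lra|]. specialize (Hh z). lra. }
    lra.
Qed.

(** * The theta series and its product formula *)

Section Theta.
Variable p : R.
Hypothesis Hp : 0 < p < 1.

Lemma ln_p_neg : ln p < 0.
Proof. rewrite <- ln_1. apply ln_increasing; lra. Qed.

(** With s = |n|, the exponent plus s is at most -a s^2 + (|b| + 1) s + c. The maximum of this,
    found by completing the square, is the exponent in the chosen constant; the extra 1 pays for
    e^(-|n|). *)
Lemma gauss_bound (a b c : R) : 0 < a ->
  exists K, forall n : Z, exp (- a * (IZR n * IZR n) + b * IZR n + c) <= K * geo n.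
Proof.
  intros Ha. exists (exp ((Rabs b + 1) * (Rabs b + 1) / (4 * a) + c)). intros n.
  rewrite geo_exp, <- exp_plus.
  assert (H : - a * (IZR n * IZR n) + b * IZR n + c
     <= (Rabs b + 1) * (Rabs b + 1) / (4 * a) + c + - IZR (Z.abs n)).
  { rewrite abs_IZR.
    assert (Hb : b * IZR n <= Rabs b * Rabs (IZR n)) by (rewrite <- Rabs_mult; apply Rle_abs).
    assert (Hs : IZR n * IZR n = Rabs (IZR n) * Rabs (IZR n)) by (rewrite <- Rabs_mult; symmetry; apply Rabs_pos_eq, Rle_0_sqr).
    rewrite Hs. set (s := Rabs (IZR n)) in *. set (B := Rabs b) in *.
    assert (0 <= a * ((s - (B + 1) / (2 * a)) * (s - (B + 1) / (2 * a)))).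
    { apply Rmult_le_pos; [lra|]. apply Rle_0_sqr. }
    replace (a * ((s - (B + 1) / (2 * a)) * (s - (B + 1) / (2 * a))))
      with (a * (s * s) - (B + 1) * s + (B + 1) * (B + 1) / (4 * a)) in H by (field; lra).
    lra. }
  destruct H as [H|H]; [left; apply exp_increasing; exact H|right; rewrite H; reflexivity].
Qed.

Lemma norm1_Cexp (z : CC) : norm1 (Cexp z) <= 2 * exp (Re z).
Proof.
  unfold norm1; simpl. rewrite !Rabs_mult, (Rabs_pos_eq (exp (Re z))) by (left; apply exp_pos).
  pose proof (exp_pos (Re z)).
  assert (Rabs (cos (Im z)) <= 1) by (apply Rabs_le, COS_bound).
  assert (Rabs (sin (Im z)) <= 1) by (apply Rabs_le, SIN_bound).
  nra.
Qed.

Lemma norm1_RtoC (r : R) : norm1 (RtoC r) = Rabs r.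
Proof. unfold norm1; simpl. rewrite Rabs_R0; lra. Qed.

Lemma RtoC_mul (r r' : R) : RtoC (r * r') = (RtoC r * RtoC r')%CC.
Proof. apply CC_ext; simpl; ring. Qed.

(** Comes from (n + 1/2)^2 + (m + 1/2)^2 = (s^2 + d^2) / 2 with s = n + m + 1 and d = n - m: up to
    sign, the product of two theta terms splits into a factor in s and x and a factor in d and y. *)
Definition uterm (x : CC) (s : Z) : CC :=
  (RtoC (Rpower p (IZR s * IZR s / 2)) * Cexp (RtoC (- (2 * IZR s)) * x))%CC.

Lemma uterm_dominated (x : CC) : dominated (uterm x).
Proof.
  pose proof ln_p_neg as Hl.
  destruct (gauss_bound (- ln p / 2) (- (2 * Re x)) 0) as [K HK]; [lra|].
  exists (2 * K). intros n. unfold uterm.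
  eapply Rle_trans; [apply norm1_mul|]. rewrite norm1_RtoC. unfold Rpower.
  rewrite Rabs_pos_eq by (left; apply exp_pos).
  apply Rle_trans with (exp (IZR n * IZR n / 2 * ln p) * (2 * exp (- (2 * IZR n) * Re x - 0 * Im x))).
  - apply Rmult_le_compat_l; [left; apply exp_pos|]. apply norm1_Cexp.
  - replace (exp (IZR n * IZR n / 2 * ln p) * (2 * exp (- (2 * IZR n) * Re x - 0 * Im x)))
      with (2 * (exp (IZR n * IZR n / 2 * ln p) * exp (- (2 * IZR n) * Re x - 0 * Im x))) by ring.
    rewrite <- exp_plus, Rmult_assoc. apply Rmult_le_compat_l; [lra|].
    eapply Rle_trans; [|apply HK]. right. f_equal. lra.
Qed.

Lemma sgn_sqr (n : Z) : powerRZ (-1) n * powerRZ (-1) n = 1.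
Proof. rewrite <- powerRZ_mult. replace (-1 * -1) with 1 by ring. apply powerRZ_R1. Qed.

Lemma sgn_add (n m : Z) :
  powerRZ (-1) n * powerRZ (-1) m = if Z.even (n + m + 1) then -1 else 1.
Proof.
  rewrite <- powerRZ_add by lra. destruct (Z.even (n + m + 1)) eqn:E.
  - apply Z.even_spec in E. destruct E as [k Hk].
    replace (n + m)%Z with (k + k + - (1))%Z by lia.
    rewrite !powerRZ_add by lra. rewrite sgn_sqr. simpl. field.
  - assert (Ho : Z.odd (n + m + 1) = true) by (rewrite <- Z.negb_even, E; reflexivity).
    apply Z.odd_spec in Ho. destruct Ho as [k Hk].
    replace (n + m)%Z with (k + k)%Z by lia.
    rewrite powerRZ_add by lra. apply sgn_sqr.
Qed.

Lemma theta_term_dominated (x : CC) : dominated (theta_term p x).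
Proof.
  pose proof ln_p_neg as Hl.
  destruct (gauss_bound (- ln p) (ln p - 2 * Re x) (ln p / 4 - Re x)) as [K HK]; [lra|].
  exists (2 * K). intros n. unfold theta_term.
  eapply Rle_trans; [apply norm1_mul|].
  replace (norm1 (- Ci * RtoC (powerRZ (-1) n))%CC) with 1.
  2:{ unfold norm1; simpl.
      replace (- 0 * powerRZ (-1) n - - (1) * 0) with 0 by ring.
      replace (- 0 * 0 + - (1) * powerRZ (-1) n) with (- powerRZ (-1) n) by ring.
      rewrite Rabs_R0, Rabs_Ropp.
      pose proof (f_equal Rabs (sgn_sqr n)) as H. rewrite Rabs_mult, Rabs_R1 in H.
      pose proof (Rabs_pos (powerRZ (-1) n)). nra. }
  rewrite Rmult_1_l.
  eapply Rle_trans; [apply norm1_mul|]. rewrite norm1_RtoC. unfold Rpower.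
  rewrite Rabs_pos_eq by (left; apply exp_pos).
  apply Rle_trans with (exp ((IZR n + / 2) ^ 2 * ln p) * (2 * exp (- (2 * IZR n + 1) * Re x - 0 * Im x))).
  - apply Rmult_le_compat_l; [left; apply exp_pos|]. apply norm1_Cexp.
  - replace (exp ((IZR n + / 2) ^ 2 * ln p) * (2 * exp (- (2 * IZR n + 1) * Re x - 0 * Im x)))
      with (2 * (exp ((IZR n + / 2) ^ 2 * ln p) * exp (- (2 * IZR n + 1) * Re x - 0 * Im x))) by ring.
    rewrite <- exp_plus, Rmult_assoc. apply Rmult_le_compat_l; [lra|].
    eapply Rle_trans; [|apply HK]. right. f_equal. field.
Qed.

Lemma Cexp_add (z w : CC) : Cexp (z + w)%CC = (Cexp z * Cexp w)%CC.
Proof.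
  apply CC_ext; simpl; rewrite exp_plus; [rewrite cos_plus|rewrite sin_plus]; ring.
Qed.

Definition uterm_even (x : CC) (s : Z) : CC := if Z.even s then uterm x s else C0.
Definition uterm_odd (x : CC) (s : Z) : CC := if Z.even s then C0 else uterm x s.

Lemma uterm_even_dominated (x : CC) : dominated (uterm_even x).
Proof.
  destruct (uterm_dominated x) as [K HK]. exists K. intros n. unfold uterm_even.
  destruct (Z.even n); [apply HK|]. eapply Rle_trans; [|apply (HK n)].
  unfold norm1 at 1; simpl. rewrite Rabs_R0. pose proof (norm1_pos (uterm x n)). lra.
Qed.

Lemma uterm_odd_dominated (x : CC) : dominated (uterm_odd x).
Proof.
  destruct (uterm_dominated x) as [K HK]. exists K. intros n. unfold uterm_odd.
  destruct (Z.even n); [|apply HK]. eapply Rle_trans; [|apply (HK n)].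
  unfold norm1 at 1; simpl. rewrite Rabs_R0. pose proof (norm1_pos (uterm x n)). lra.
Qed.

(** The indices n + m + 1 and n - m have opposite parity, and the sign of the product of the two
    theta terms is + or - as n + m + 1 is even or odd. Pairs of equal parity contribute zero, so the
    sum may run over a full square. *)
Definition wterm (x y : CC) (z : Z * Z) : CC :=
  (uterm_even x (fst z) * uterm_odd y (snd z) - uterm_odd x (fst z) * uterm_even y (snd z))%CC.

Lemma theta_term_mul (x y : CC) (n m : Z) :
  (theta_term p (x + y) n * theta_term p (x - y) m)%CC = wterm x y (rot (n, m)).
Proof.
  assert (Hu : (RtoC (Rpower p ((IZR n + / 2) ^ 2)) * Cexp (RtoC (- (2 * IZR n + 1)) * (x + y))
     * (RtoC (Rpower p ((IZR m + / 2) ^ 2)) * Cexp (RtoC (- (2 * IZR m + 1)) * (x - y)))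
     = uterm x (n + m + 1) * uterm y (n - m))%CC).
  { unfold uterm.
    transitivity (RtoC (Rpower p ((IZR n + / 2) ^ 2 + (IZR m + / 2) ^ 2))
      * Cexp (RtoC (- (2 * IZR n + 1)) * (x + y) + RtoC (- (2 * IZR m + 1)) * (x - y)))%CC.
    { rewrite Cexp_add, Rpower_plus. rewrite RtoC_mul. ring. }
    transitivity (RtoC (Rpower p (IZR (n + m + 1) * IZR (n + m + 1) / 2 + IZR (n - m) * IZR (n - m) / 2))
      * Cexp (RtoC (- (2 * IZR (n + m + 1))) * x + RtoC (- (2 * IZR (n - m))) * y))%CC.
    2:{ rewrite Cexp_add, Rpower_plus. rewrite RtoC_mul. ring. }
    rewrite minus_IZR, !plus_IZR. f_equal.
    - f_equal. f_equal. field.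
    - f_equal. apply CC_ext; simpl; ring. }
  pose proof (sgn_add n m) as Hs.
  unfold theta_term.
  transitivity (- (RtoC (powerRZ (-1) n * powerRZ (-1) m)) * (uterm x (n + m + 1) * uterm y (n - m)))%CC.
  { rewrite <- Hu.
    replace (- RtoC (powerRZ (-1) n * powerRZ (-1) m))%CC
      with ((- Ci * RtoC (powerRZ (-1) n)) * (- Ci * RtoC (powerRZ (-1) m)))%CC
      by (apply CC_ext; simpl; ring). ring. }
  rewrite Hs. unfold wterm, rot, uterm_even, uterm_odd; simpl fst; simpl snd.
  assert (Hpar : Z.even (n - m) = negb (Z.even (n + m + 1))).
  { rewrite Z.even_sub, !Z.even_add. destruct (Z.even n), (Z.even m); reflexivity. }
  rewrite Hpar. destruct (Z.even (n + m + 1)); simpl negb; cbv iota.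
  - replace (- RtoC (-1))%CC with C1 by (apply CC_ext; simpl; ring). ring.
  - replace (- RtoC 1)%CC with (- C1)%CC by reflexivity. ring.
Qed.

Lemma theta_cv (x : CC) : exists l,
  Cseq_cv (fun N => Csum (map (theta_term p x) (zrange N))) l /\ theta p x = (RtoC (/ 2) * l)%CC.
Proof.
  destruct (dominated_cv _ (theta_term_dominated x)) as [l Hl]. exists l. split; [exact Hl|].
  unfold theta. apply Clim_eq. apply Cseq_cv_mul; [apply Cseq_cv_const|exact Hl].
Qed.

(** Classically [even_part x] and [odd_part x] are the theta functions Theta_3 and Theta_2 at 2 i x
    with nome p^2. *)
Definition even_part (x : CC) : CC := Clim (fun N => Csum (map (uterm_even x) (zrange N))).
Definition odd_part (x : CC) : CC := Clim (fun N => Csum (map (uterm_odd x) (zrange N))).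

Lemma Csum_sub {T} (f h : T -> CC) (l : list T) :
  Csum (map (fun t => f t - h t)%CC l) = (Csum (map f l) - Csum (map h l))%CC.
Proof. induction l as [|t l IH]; simpl; [ring|]. rewrite IH; ring. Qed.

Lemma theta_mul (x y : CC) :
  (theta p (x + y) * theta p (x - y)
   = RtoC (/ 4) * (even_part x * odd_part y - odd_part x * even_part y))%CC.
Proof.
  destruct (theta_cv (x + y)%CC) as [lp [Hlp ->]]. destruct (theta_cv (x - y)%CC) as [lm [Hlm ->]].
  destruct (dominated_cv _ (uterm_even_dominated x)) as [ex Hex].
  destruct (dominated_cv _ (uterm_odd_dominated x)) as [ox Hox].
  destruct (dominated_cv _ (uterm_even_dominated y)) as [ey Hey].
  destruct (dominated_cv _ (uterm_odd_dominated y)) as [oy Hoy].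
  unfold even_part, odd_part.
  rewrite (Clim_eq _ _ Hex), (Clim_eq _ _ Hox), (Clim_eq _ _ Hey), (Clim_eq _ _ Hoy).
  destruct (uterm_even_dominated x) as [K1 HK1]. destruct (uterm_odd_dominated x) as [K2 HK2].
  destruct (uterm_even_dominated y) as [K3 HK3]. destruct (uterm_odd_dominated y) as [K4 HK4].
  enough (E : (lp * lm = ex * oy - ox * ey)%CC).
  { rewrite <- E. replace (RtoC (/ 4)) with (RtoC (/ 2) * RtoC (/ 2))%CC by (apply CC_ext; simpl; field). ring. }
  destruct (zsum_nonneg_cv geo 1) as [q Hq].
  { intros n. pose proof (geo_pos n). lra. }
  (* The first sequence is the product of partial sums of the two theta series, the second a
     combination of products of partial sums in x and in y. The third bounds their distance by the
     mass between two squares, which tends to q^2 - q^2. *)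
  apply (Cseq_cv_squeeze
    (fun M => Csum (map (wterm x y) (map rot (box (S M)))))
    (fun M => Csum (map (wterm x y) (box M)))
    (fun M => (K1 * K4 + K2 * K3) * (Rsum (map geo (zrange (2 * M + 3))) * Rsum (map geo (zrange (2 * M + 3)))
          - Rsum (map geo (zrange M)) * Rsum (map geo (zrange M))))).
  - pose proof (Cseq_cv_mul _ _ _ _ Hlp Hlm) as [H1 H2].
    assert (E : forall M, Csum (map (wterm x y) (map rot (box (S M))))
      = (Csum (map (theta_term p (x + y)) (zrange (S M))) * Csum (map (theta_term p (x - y)) (zrange (S M))))%CC).
    { intros M. rewrite <- Csum_prod, map_map. apply Csum_ext. intros [n m] _.
      rewrite <- theta_term_mul. reflexivity. }
    split; intros eps He; [destruct (H1 eps He) as [N0 HN]|destruct (H2 eps He) as [N0 HN]];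
      exists N0; intros n Hn; rewrite E; apply (HN (S n)); lia.
  - pose proof (Cseq_cv_sub _ _ _ _ (Cseq_cv_mul _ _ _ _ Hex Hoy) (Cseq_cv_mul _ _ _ _ Hox Hey)) as [H1 H2].
    assert (E : forall M, Csum (map (wterm x y) (box M))
      = (Csum (map (uterm_even x) (zrange M)) * Csum (map (uterm_odd y) (zrange M))
         - Csum (map (uterm_odd x) (zrange M)) * Csum (map (uterm_even y) (zrange M)))%CC).
    { intros M. rewrite <- !Csum_prod, <- Csum_sub. reflexivity. }
    split; intros eps He; [destruct (H1 eps He) as [N0 HN]|destruct (H2 eps He) as [N0 HN]];
      exists N0; intros n Hn; rewrite E; apply (HN n); lia.
  - intros M. apply box_compare.
    + intros s d H. unfold wterm, uterm_even, uterm_odd; simpl. rewrite Z.even_add in H.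
      destruct (Z.even s), (Z.even d); try discriminate H; ring.
    + intros [s d]. unfold wterm; simpl.
      pose proof (geo_pos s). pose proof (geo_pos d).
      eapply Rle_trans; [apply norm1_add|]. rewrite norm1_opp.
      pose proof (norm1_mul (uterm_even x s) (uterm_odd y d)).
      pose proof (norm1_mul (uterm_odd x s) (uterm_even y d)).
      assert (norm1 (uterm_even x s) * norm1 (uterm_odd y d) <= (K1 * geo s) * (K4 * geo d))
        by (apply Rmult_le_compat; auto using norm1_pos).
      assert (norm1 (uterm_odd x s) * norm1 (uterm_even y d) <= (K2 * geo s) * (K3 * geo d))
        by (apply Rmult_le_compat; auto using norm1_pos).
      lra.
  - replace 0 with ((K1 * K4 + K2 * K3) * (q * q - q * q)) by ring.
    pose proof (Un_cv_subseq _ (fun M => (2 * M + 3)%nat) _ ltac:(intros; cbv beta; lia) Hq) as Hq'. cbv beta in Hq'.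
    apply CV_mult; [intros eps He; exists 0%nat; intros; rewrite Rdist_eq; exact He|].
    apply CV_minus; apply CV_mult; assumption.
Qed.

Local Open Scope CC_scope.

Lemma RtoC_half (z : CC) : RtoC (/ 2) * z + RtoC (/ 2) * z = z.
Proof. apply CC_ext; simpl; field. Qed.

Lemma theta_odd (z : CC) : theta p (- z) = - theta p z.
Proof.
  (* swapping x and y in the addition formula: [b][a] = - [b][- a] for all a, b *)
  assert (H : forall a b, theta p b * theta p a = - (theta p b * theta p (- a))).
  { intros a b.
    set (x := RtoC (/ 2) * (a + b)). set (y := RtoC (/ 2) * (b - a)).
    replace b with (x + y) by (rewrite <- (RtoC_half b); unfold x, y; ring).
    replace a with (x - y) at 1 by (rewrite <- (RtoC_half a); unfold x, y; ring).
    replace (- a) with (y - x) by (rewrite <- (RtoC_half a); unfold x, y; ring).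
    rewrite theta_mul. replace (x + y) with (y + x) by ring. rewrite theta_mul. ring. }
  (* Dividing by [-z] requires [-z] to be nonzero; if it vanishes, a = b = z gives [z]^2 = 0. *)
  destruct (excluded_middle_informative (theta p (- z) = C0)) as [E|E].
  - pose proof (H z z) as Hz. rewrite E in Hz |- *.
    destruct (CC_integral (theta p z) (theta p z)) as [E'|E']; try (rewrite E'; ring).
    rewrite Hz; ring.
  - apply (Cmul_cancel_l (theta p (- z)) _ _ E).
    transitivity (- - (theta p (- z) * theta p (- z))); [ring|]. rewrite <- (H z (- z)). ring.
Qed.

(* The Pluecker relation for the rank two form of the addition formula. *)
Lemma theta_three_term (a b c T : CC) :
  theta p (a + c) * theta p b * theta p T * theta p (T - c + a + b)
  = theta p c * theta p (a + b) * theta p (T + a) * theta p (T + b - c)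
    + theta p a * theta p (b - c) * theta p (T - c) * theta p (T + a + b).
Proof.
  (* The half-sums are chosen so that the sums and differences of the six pairs of points are the
     twelve arguments of the relation, two of them up to sign. *)
  set (h := RtoC (/ 2)).
  set (x := h * (a + b + c)). set (z := h * (a + c - b)).
  set (y := h * (T + T + a + b - c)). set (w := h * (a + b - c)).
  assert (Hd : forall s s' : CC, s' = h * (s + s) -> s' = s).
  { intros s s' ->. transitivity (h * s + h * s); [ring|apply RtoC_half]. }
  pose proof (theta_mul x z) as M1. pose proof (theta_mul y w) as M2.
  pose proof (theta_mul x w) as M3. pose proof (theta_mul y z) as M4.
  pose proof (theta_mul x y) as M5. pose proof (theta_mul z w) as M6.
  rewrite (Hd (a + c) (x + z)), (Hd b (x - z)) in M1 by (unfold x, z; ring).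
  rewrite (Hd (T - c + a + b) (y + w)), (Hd T (y - w)) in M2 by (unfold y, w; ring).
  rewrite (Hd (a + b) (x + w)), (Hd c (x - w)) in M3 by (unfold x, w; ring).
  rewrite (Hd (T + a) (y + z)), (Hd (T + b - c) (y - z)) in M4 by (unfold y, z; ring).
  rewrite (Hd (T + a + b) (x + y)), (Hd (- (T - c)) (x - y)), theta_odd in M5 by (unfold x, y; ring).
  rewrite (Hd a (z + w)), (Hd (- (b - c)) (z - w)), theta_odd in M6 by (unfold z, w; ring).
  transitivity ((theta p (a + c) * theta p b) * (theta p (T - c + a + b) * theta p T)); [ring|].
  transitivity ((theta p (a + b) * theta p c) * (theta p (T + a) * theta p (T + b - c))
    + (theta p (T + a + b) * - theta p (T - c)) * (theta p a * - theta p (b - c))); [|ring].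
  rewrite M1, M2, M3, M4, M5, M6. ring.
Qed.
End Theta.

Local Open Scope CC_scope.

Lemma Csum_lin {T} (c d : CC) (f h : T -> CC) (l : list T) :
  Csum (map (fun t => c * f t + d * h t) l) = c * Csum (map f l) + d * Csum (map h l).
Proof. induction l as [|t l IH]; simpl; [ring|]. rewrite IH; ring. Qed.

Opaque theta.

(** * Exchange relations *)

Section Algebra.

Variables (p : R) (g : CC).
Notation th := (theta p).
Hypothesis Hp : (0 < p < 1)%R.

Let th_odd : forall z, th (- z) = - th z := theta_odd p Hp.

(** The twelve arguments are free variables tied down by equations, so that an instance can be
    written with the arguments in the form in which a goal shows them; [ring] checks each one, and
    [rewrite <-] replaces [C0] by the instance. *)
Lemma three_term_at (a b c T z1 z2 z3 z4 w1 w2 w3 w4 y1 y2 y3 y4 : CC) :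
  z1 = a + c -> z2 = b -> z3 = T -> z4 = T - c + a + b ->
  w1 = c -> w2 = a + b -> w3 = T + a -> w4 = T + b - c ->
  y1 = a -> y2 = b - c -> y3 = T - c -> y4 = T + a + b ->
  th z1 * th z2 * th z3 * th z4 - th w1 * th w2 * th w3 * th w4
    - th y1 * th y2 * th y3 * th y4 = C0.
Proof. intros. subst. rewrite (theta_three_term p Hp). ring. Qed.

Lemma th_flip (z w : CC) : w = - z -> th w = - th z.
Proof. intros ->; apply th_odd. Qed.

(* Column of the monodromy matrix with auxiliary input v2: [op mus true] is B and
   [op mus false] is D. *)
Fixpoint op (mus : list CC) (b : bool) (x tau : CC) (v : list bool -> CC) (so : list bool) : CC :=
  match mus, so with
  | nil, nil => if b then C0 else v nil
  | mu :: mus', q :: so' =>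
      let R := Rmat p g (x - mu) (tau - g * sum_h so') b q in
      R true true * op mus' true x tau (fun s => v (true :: s)) so'
      + R true false * op mus' true x tau (fun s => v (false :: s)) so'
      + R false true * op mus' false x tau (fun s => v (true :: s)) so'
      + R false false * op mus' false x tau (fun s => v (false :: s)) so'
  | _, _ => C0
  end.

Lemma op_mono (mus : list CC) (b : bool) (x tau : CC) (v : list bool -> CC) (so : list bool) :
  Csum (map (fun si => mono p g x tau mus b so si false * v si) (states (length mus)))
  = op mus b x tau v so.
Proof.
  revert b v so; induction mus as [|mu mus IH]; intros b v so.
  - destruct so, b; simpl; ring.
  - destruct so as [|q so].
    + simpl. rewrite map_app, !map_map, Csum_app. simpl.
      assert (H : forall l, Csum (map (fun si => C0 * v (true :: si)) l) = C0
                 /\ Csum (map (fun si => C0 * v (false :: si)) l) = C0).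
      { induction l as [|s l [H1 H2]]; simpl; [tauto|]. rewrite H1, H2; split; ring. }
      rewrite (proj1 (H _)), (proj2 (H _)); ring.
    + cbn [length states]. rewrite map_app, !map_map, Csum_app. cbn [op].
      rewrite <- !IH. cbn [mono map Csum fold_right].
      set (R := Rmat p g (x - mu) (tau - g * sum_h so) b q).
      assert (H : forall b', Csum (map (fun s => (R true b' * mono p g x tau mus true so s false
                       + (R false b' * mono p g x tau mus false so s false + C0)) * v (b' :: s))
                       (states (length mus)))
           = R true b' * Csum (map (fun s => mono p g x tau mus true so s false * v (b' :: s)) (states (length mus)))
           + R false b' * Csum (map (fun s => mono p g x tau mus false so s false * v (b' :: s)) (states (length mus)))).
      { intros b'. rewrite <- Csum_lin. apply Csum_ext; intros; ring. }
      rewrite !H; ring.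
Qed.

Lemma op_lin (mus : list CC) (b : bool) (x tau c d : CC) (v w : list bool -> CC) (so : list bool) :
  op mus b x tau (fun s => c * v s + d * w s) so = c * op mus b x tau v so + d * op mus b x tau w so.
Proof.
  revert b v w so; induction mus as [|mu mus IH]; intros b v w [|q so]; cbn [op].
  - destruct b; ring.
  - ring.
  - ring.
  - rewrite !IH; ring.
Qed.

Lemma op_scal (mus : list CC) (b : bool) (x tau c : CC) (v : list bool -> CC) (so : list bool) :
  op mus b x tau (fun s => c * v s) so = c * op mus b x tau v so.
Proof.
  transitivity (op mus b x tau (fun s => c * v s + C0 * v s) so).
  - f_equal; apply functional_extensionality; intros; ring.
  - rewrite op_lin; ring.
Qed.

(* The six-vertex ice rule: only states of the right total weight contribute. *)
Lemma op_ext (mus : list CC) (b : bool) (x tau : CC) (v w : list bool -> CC) (so : list bool) :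
  (forall s, length s = length mus -> sum_h s = sum_h so + C1 + heig b -> v s = w s) ->
  op mus b x tau v so = op mus b x tau w so.
Proof.
  revert b v w so; induction mus as [|mu mus IH]; intros b v w [|q so] H; cbn [op]; try reflexivity.
  - destruct b; [reflexivity|]. apply H; [reflexivity|]. simpl. ring.
  - assert (E : forall b' q', heig b' + heig q' = heig b + heig q ->
      op mus b' x tau (fun s => v (q' :: s)) so = op mus b' x tau (fun s => w (q' :: s)) so).
    { intros b' q' Hb. apply IH. intros s Hl Hs. apply H; [simpl; congruence|].
      unfold sum_h in *; simpl. rewrite Hs.
      transitivity (heig b' + heig q' + Csum (map heig so) + C1); [ring|rewrite Hb; ring]. }
    destruct b, q; cbn [Rmat];
      repeat match goal with |- context [op mus ?b' x tau (fun s => v (?q' :: s)) so] =>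
        first [rewrite (E b' q') by (simpl; ring)
              | generalize (op mus b' x tau (fun s => v (q' :: s)) so);
                generalize (op mus b' x tau (fun s => w (q' :: s)) so); intros ? ?] end; ring.
Qed.

(* The weights a, b_+, b_-, c_+, c_- of the R-matrix. *)
Definition wa (u : CC) := th (u + g).
Definition wbp (u t : CC) := th (t - g) * th u / th t.
Definition wbm (u t : CC) := th (t + g) * th u / th t.
Definition wcp (u t : CC) := th (t - u) * th g / th t.
Definition wcm (u t : CC) := th (t + u) * th g / th t.

(* In [op_Bt], [op_Bf], [op_Dt], [op_Df] the last letter is the output state of the first site. *)
Section Site.
Variables (mus : list CC) (mu x tau : CC) (v : list bool -> CC) (so : list bool).
Let u := x - mu.
Let t := tau - g * sum_h so.
Let vt := fun s => v (true :: s).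
Let vf := fun s => v (false :: s).

Lemma op_Bt : op (mu :: mus) true x tau v (true :: so) = wa u * op mus true x tau vt so.
Proof. cbn [op Rmat]. unfold wa, u, vt. ring. Qed.
Lemma op_Bf : op (mu :: mus) true x tau v (false :: so)
  = wbp u t * op mus true x tau vf so + wcp u t * op mus false x tau vt so.
Proof. cbn [op Rmat]. unfold wbp, wcp, u, t, vt, vf. ring. Qed.
Lemma op_Dt : op (mu :: mus) false x tau v (true :: so)
  = wbm u t * op mus false x tau vt so + wcm u t * op mus true x tau vf so.
Proof. cbn [op Rmat]. unfold wbm, wcm, u, t, vt, vf. ring. Qed.
Lemma op_Df : op (mu :: mus) false x tau v (false :: so) = wa u * op mus false x tau vf so.
Proof. cbn [op Rmat]. unfold wa, u, vf. ring. Qed.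
End Site.

Section Inner.
Variables (mus : list CC) (mu x1 x2 tau : CC) (v : list bool -> CC) (so : list bool) (b : bool) (t' : CC).
Hypothesis Ht' : t' = tau + g - g * (sum_h so + C1 + heig b).
Let u := x2 - mu.
Let vt := fun s => v (true :: s).
Let vf := fun s => v (false :: s).

Lemma op_inner_Bt : op mus b x1 tau (fun s => op (mu :: mus) true x2 (tau + g) v (true :: s)) so
  = wa u * op mus b x1 tau (op mus true x2 (tau + g) vt) so.
Proof. rewrite <- op_scal. apply op_ext; intros. apply op_Bt. Qed.
Lemma op_inner_Df : op mus b x1 tau (fun s => op (mu :: mus) false x2 (tau + g) v (false :: s)) so
  = wa u * op mus b x1 tau (op mus false x2 (tau + g) vf) so.
Proof. rewrite <- op_scal. apply op_ext; intros. apply op_Df. Qed.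
(** The weights of the inner operator see the intermediate state only through its total weight,
    which the ice rule fixes as [sum_h so + C1 + heig b]. The parameter is therefore the number
    [t'], and the weights can be pulled out of the outer operator. *)
Lemma op_inner_Bf : op mus b x1 tau (fun s => op (mu :: mus) true x2 (tau + g) v (false :: s)) so
  = wbp u t' * op mus b x1 tau (op mus true x2 (tau + g) vf) so
    + wcp u t' * op mus b x1 tau (op mus false x2 (tau + g) vt) so.
Proof. rewrite <- op_lin. apply op_ext; intros s _ Hs. rewrite op_Bf, Hs, <- Ht'. reflexivity. Qed.
Lemma op_inner_Dt : op mus b x1 tau (fun s => op (mu :: mus) false x2 (tau + g) v (true :: s)) so
  = wbm u t' * op mus b x1 tau (op mus false x2 (tau + g) vt) so
    + wcm u t' * op mus b x1 tau (op mus true x2 (tau + g) vf) so.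
Proof. rewrite <- op_lin. apply op_ext; intros s _ Hs. rewrite op_Dt, Hs, <- Ht'. reflexivity. Qed.
End Inner.

(** Serves certificates: the difference of the two sides of a goal is written as a linear
    combination of differences of known equations; [field] or [ring] checks the combination, and
    rewriting with the equations makes it zero. *)
Ltac diff H := match type of H with ?l = ?r => constr:(l - r) end.

Lemma Cmul_neq0 (z w : CC) : z <> C0 -> w <> C0 -> z * w <> C0.
Proof. intros Hz Hw H. destruct (CC_integral _ _ H); auto. Qed.

(** * Instances of the three-term relation needed for the coefficients *)

Section Coefficients.
Variables u v t : CC.

(** Up to the factor [g], the coefficient of [BD21] in [BB_coef] after elimination of [DB12] and
    [DB21]; exchanging u and v gives that of [BD12]. *)
Lemma theta_id_BB : th t * th (t - u) * th (v + g) * th (u - v + g)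
   - th (t - (u - v)) * th (t - v) * th (u + g) * th g
   - th (u - v) * th v * th (t - g - u) * th (t + g) = C0.
Proof.
  rewrite <- (three_term_at (u - v) (t - u) (t - (u - v)) (v + g)
     t (t - u) (v + g) (u - v + g) (t - (u - v)) (t - v) (u + g) g
     (u - v) (- v) (- (t - g - u)) (t + g)) by ring.
  rewrite !th_odd. ring.
Qed.

Lemma theta_id_DBt : th u * th (v + g) * th (t + (u - v)) * th (t - g)
   - th (u + g) * th v * th (t - g + (u - v)) * th t
   - th g * th (u - v) * th (t - g - v) * th (t + u) = C0.
Proof.
  rewrite <- (three_term_at (- g) (v + g) (u + g) (t + (u - v))
     u (v + g) (t + (u - v)) (t - g) (u + g) v (t - g + (u - v)) t
     (- g) (- (u - v)) (t - g - v) (t + u)) by ring.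
  rewrite !th_odd. ring.
Qed.

Lemma theta_id_DBtf : th (u - v) * th (t + u) * th (t - g - g) * th v
   - th (t - g + (u - v)) * th (u + g) * (- th g) * th (t - g + v)
   - th (t - g) * th (v + g) * th (u - v + g) * th (t - g + u) = C0.
Proof.
  rewrite <- (three_term_at (- (t - g)) (t + u) (t - g + (u - v)) (t - g - g)
     (u - v) (t + u) (t - g - g) v (t - g + (u - v)) (u + g) (- g) (t - g + v)
     (- (t - g)) (v + g) (- (u - v + g)) (t - g + u)) by ring.
  rewrite !th_odd. ring.
Qed.

Lemma theta_id_DD : th u * th (t + g + v) * th g * th (t + (u - v))
   - th (v + g) * th (t + u) * th (u - v) * th (t + g)
   + th (u - v - g) * th t * th v * th (t + g + u) = C0.
Proof.
  rewrite <- (three_term_at (u - v - g) (t + g + v) (v + g) g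
     u (t + g + v) g (t + (u - v)) (v + g) (t + u) (u - v) (t + g)
     (u - v - g) t (- v) (t + g + u)) by ring.
  rewrite !th_odd. ring.
Qed.

Lemma theta_id_K1 : th t * th t * th t * th (t + g + g)
   - th (t + g) * th (t + g) * th (t + g) * th (t - g)
   - th g * th g * th g * th (t + t + g) = C0.
Proof.
  rewrite <- (three_term_at g t (t - g) t
     t t t (t + g + g) (t - g) (t + g) (t + g) (t + g) g g g (t + t + g)) by ring.
  ring.
Qed.

Lemma theta_id_K2 : th (t + g) * th (t - v) * th (t + g + u) * th (t - (u - v))
   - th (t + g + (u - v)) * th (t - u) * th (t + g + v) * th t
   - th (u - v) * th (u + g) * th v * th (t + t + g) = C0.
Proof.
  rewrite <- (three_term_at (- (u - v)) (t - v) (t + g + (u - v)) (t + g + u)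
     (t + g) (t - v) (t + g + u) (t - (u - v)) (t + g + (u - v)) (t - u) (t + g + v) t
     (- (u - v)) (- (u + g)) v (t + t + g)) by ring.
  rewrite !th_odd. ring.
Qed.

Lemma theta_id_K3 : th (u - v + g) * th (u - v - g) * th t * th t
   - th (u - v) * th (u - v) * th (t + g) * th (t - g)
   + th g * th g * th (t - (u - v)) * th (t + (u - v)) = C0.
Proof.
  rewrite <- (three_term_at g (u - v - g) (u - v) t
     (u - v + g) (u - v - g) t t (u - v) (u - v) (t + g) (t - g)
     g (- g) (t - (u - v)) (t + (u - v))) by ring.
  rewrite !th_odd. ring.
Qed.

Lemma theta_id_K4 : th (t - v) * th (t + g + u) * th g * th (u - v)
   + th (t + g) * th (t + (u - v)) * th v * th (u + g)
   - th (v + g) * th u * th t * th (t + g + (u - v)) = C0.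
Proof.
  rewrite <- (three_term_at (- (v + g)) (t + g + u) (t + g) g
     (t - v) (t + g + u) g (u - v) (t + g) (t + (u - v)) (- v) (u + g)
     (- (v + g)) u (- t) (t + g + (u - v))) by ring.
  rewrite !th_odd. ring.
Qed.

Lemma theta_id_F : th (u - v) * th (u + g) * th (t + g - v) * th t
   - th (u - v + g) * th u * th (t - v) * th (t + g)
   + th g * th v * th (t - u) * th (t + g + (u - v)) = C0.
Proof.
  rewrite <- (three_term_at (- g) (u + g) (u - v + g) (t + g - v)
     (u - v) (u + g) (t + g - v) t (u - v + g) u (t - v) (t + g)
     (- g) v (t - u) (t + g + (u - v))) by ring.
  rewrite !th_odd. ring.
Qed.
End Coefficients.

Lemma wbm_swap (u v t t' : CC) : wbm u t * wbm v t' = wbm v t * wbm u t'.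
Proof. unfold wbm, Cdiv; ring. Qed.

Lemma wbp_swap (u v t t' : CC) : wbp u t * wbp v t' = wbp v t * wbp u t'.
Proof. unfold wbp, Cdiv; ring. Qed.

(* [DB12], [BD21], ... stand for the products on the sites after the first one; each lemma is the
   exchange relation with the first site added, for one choice of its states. *)
Section Exchange_coefficients.
Variables u v t : CC.
Hypotheses (Ht : th t <> C0) (Htp : th (t + g) <> C0) (Htm : th (t - g) <> C0) (Hx : th (u - v) <> C0).
Variables DB12 BD12 DB21 BD21 : CC.
Hypothesis E12 : th (t + g) * th (u - v) * DB12 = th (u - v + g) * th t * BD21 - th (t + (u - v)) * th g * BD12.
Hypothesis E21 : th (t + g) * th (u - v) * DB21 = th (u - v - g) * th t * BD12 + th (t - (u - v)) * th g * BD21.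

(** These are the terms of the symmetry of B B with one B and one D on the remaining sites. [E12]
    and [E21] express both D B products through [BD12] and [BD21], whose coefficients then vanish
    separately. *)
Lemma BB_coef :
  wcp u t * wa v * DB12 + wbp u t * wcp v (t - g) * BD12
  = wcp v t * wa u * DB21 + wbp v t * wcp u (t - g) * BD21.
Proof.
  pose proof (theta_id_BB u v t) as W1. pose proof (theta_id_BB v u t) as W2.
  rewrite (th_flip (u - v) (v - u)), (th_flip (u - v - g) (v - u + g)) in W2 by ring.
  replace (t - (v - u)) with (t + (u - v)) in W2 by ring.
  apply (Cmul_cancel_l (th t * th (t + g) * th (u - v))); [auto using Cmul_neq0|].
  apply CC_sub_zero.
  let e1 := diff E12 in let e2 := diff E21 in let w1 := diff W1 in let w2 := diff W2 in
  transitivity (th g * (th (t - u) * th (v + g) * e1 - th (t - v) * th (u + g) * e2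
     + BD21 * w1 + BD12 * w2)).
  - unfold wa, wbp, wcp. field; auto.
  - rewrite E12, E21, W1, W2. ring.
Qed.

Lemma DD_coef :
  wbm u t * wcm v (t + g) * DB12 + wcm u t * wa v * BD12
  = wbm v t * wcm u (t + g) * DB21 + wcm v t * wa u * BD21.
Proof.
  pose proof (theta_id_DD u v t) as W1. pose proof (theta_id_DD v u t) as W2.
  rewrite (th_flip (u - v) (v - u)), (th_flip (u - v + g) (v - u - g)) in W2 by ring.
  replace (t + (v - u)) with (t - (u - v)) in W2 by ring.
  apply (Cmul_cancel_l (th t * th (t + g) * th (u - v))); [auto using Cmul_neq0|].
  apply CC_sub_zero.
  let e1 := diff E12 in let e2 := diff E21 in let w1 := diff W1 in let w2 := diff W2 in
  transitivity (th g * (th u * th (t + g + v) * e1 - th v * th (t + g + u) * e2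
     - BD12 * w1 - BD21 * w2)).
  - unfold wa, wbm, wcm. field; auto.
  - rewrite E12, E21, W1, W2. ring.
Qed.

(** The same [BB12] stands on both sides because the symmetry of B B on the remaining sites is
    already available. *)
Lemma DB_coef_t (BB12 : CC) :
  th t * th (u - v) * (wbm u t * (wa v * DB12)
      + wcm u t * (wbp v (t - g) * BB12 + wcp v (t - g) * BD12))
  = th (u - v + g) * th (t - g) * (wa v * (wbm u (t - g) * BD21 + wcm u (t - g) * BB12))
    - th (t - g + (u - v)) * th g * (wa u * (wbm v (t - g) * BD12 + wcm v (t - g) * BB12)).
Proof.
  pose proof (theta_id_DBt u v t) as W1. pose proof (theta_id_DBtf u v t) as W2.
  unfold wa, wbm, wcm, wbp, wcp.
  replace (t - g + g) with t by ring.
  apply (Cmul_cancel_l (th (t - g))); [assumption|].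
  apply CC_sub_zero.
  let e1 := diff E12 in let w1 := diff W1 in let w2 := diff W2 in
  transitivity (th u * th (v + g) * th (t - g) * e1 - th g * BD12 * w1 + th g * BB12 * w2).
  - field; auto.
  - rewrite E12, W1, W2. ring.
Qed.

(* The coefficient of [DB12] in [DB_coef_f] once denominators are cleared. *)
Let K := th (t + g + g) * th (u - v) * th (u + g) * th t * th t * th v
   + th g * th g * th g * th (t + g + (u - v)) * th (t - u) * th (t + g + v).

(** [K] itself is a sum of two products; multiplied by [t] it can be rewritten, since [theta_id_K1]
    and [theta_id_K2] share the factor [2 t + g], which cancels in the combination below. *)
Lemma theta_id_I1 : K * th t
   - th (u - v) * th (t + g) * th (t + g) * th (t + g) * th (t - g) * th v * th (u + g)
   - th (t + g) * th (t - v) * th (t + g + u) * th g * th g * th g * th (t - (u - v)) = C0.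
Proof.
  pose proof (theta_id_K1 t) as W1. pose proof (theta_id_K2 u v t) as W2.
  let w1 := diff W1 in let w2 := diff W2 in
  transitivity (th (u - v) * th (u + g) * th v * w1 - th g * th g * th g * w2).
  - unfold K. ring.
  - rewrite W1, W2. ring.
Qed.

Lemma theta_id_I2 : K * th (t + (u - v)) * th g
   + th (u - v + g) * th (t + g) * th (t - v) * th (t + g + u) * th g * th g * th (u - v - g) * th t
   - th (t + g + (u - v)) * th g * th (t - g) * th u * th (v + g) * th (t + g) * th (t + g) * th (u - v) = C0.
Proof.
  pose proof theta_id_I1 as I1.
  pose proof (theta_id_K3 u v t) as W3. pose proof (theta_id_K4 u v t) as W4.
  (* The factor [t] allows [K] to be eliminated by [theta_id_I1]. *)
  apply (Cmul_cancel_l (th t)); [assumption|].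
  let i1 := diff I1 in let w3 := diff W3 in let w4 := diff W4 in
  transitivity (th (t + (u - v)) * th g * i1 + th g * th (t + g) *
    (th (u - v) * th (t + g) * th (t - g) * w4 + th (t - v) * th (t + g + u) * th g * w3)).
  - ring.
  - rewrite I1, W3, W4. ring.
Qed.

(** Here [DB12] occurs on both sides and [DB21] occurs as well, so both relations are used. The
    coefficients left for [BD21], [BD12] and [DD12] vanish by [theta_id_I1], [theta_id_I2] and
    [theta_id_F]. *)
Lemma DB_coef_f (DD12 : CC) :
  th (t + g + g) * th (u - v) * (wa u * (wbp v (t + g) * DB12 + wcp v (t + g) * DD12))
  = th (u - v + g) * th (t + g) * (wbp v t * (wa u * BD21)
        + wcp v t * (wbm u (t + g) * DD12 + wcm u (t + g) * DB21))
    - th (t + g + (u - v)) * th g * (wbp u t * (wa v * BD12)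
        + wcp u t * (wbm v (t + g) * DD12 + wcm v (t + g) * DB12)).
Proof.
  pose proof theta_id_I1 as I1. pose proof theta_id_I2 as I2.
  pose proof (theta_id_F u v t) as W.
  unfold wa, wbm, wcm, wbp, wcp.
  replace (t + g - g) with t by ring.
  apply (Cmul_cancel_l (th t * th (t + g) * th (t + g) * th (u - v))); [auto using Cmul_neq0|].
  apply CC_sub_zero.
  let e1 := diff E12 in let e2 := diff E21 in let i1 := diff I1 in let i2 := diff I2 in let w := diff W in
  transitivity (K * e1
    - th (u - v + g) * th (t + g) * th (t - v) * th (t + g + u) * th g * th g * e2
    + BD21 * th (u - v + g) * i1 - BD12 * i2
    + DD12 * th g * th (t + g + g) * th (t + g) * th (u - v) * w).
  - unfold K. field; auto.
  - rewrite E12, E21, I1, I2, W. ring.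
Qed.
End Exchange_coefficients.

(** * Exchange relations by induction on the sites *)

Definition regular (tau : CC) (n : nat) : Prop :=
  forall m : Z, (Z.abs m <= Z.of_nat n)%Z -> th (tau + CZ m * g) <> C0.

Lemma CZ_add (m n : Z) : CZ (m + n) = CZ m + CZ n.
Proof. unfold CZ, RtoC. rewrite plus_IZR. apply CC_ext; simpl; ring. Qed.

Lemma CZ_opp (m : Z) : CZ (- m) = - CZ m.
Proof. unfold CZ, RtoC. rewrite opp_IZR. apply CC_ext; simpl; ring. Qed.

Lemma sum_h_int (so : list bool) :
  exists m, sum_h so = CZ m /\ (Z.abs m <= Z.of_nat (length so))%Z.
Proof.
  induction so as [|q so [m [Hm Hl]]].
  - exists 0%Z. split; [reflexivity|simpl; lia].
  - exists ((if q then 1 else - (1)) + m)%Z. split.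
    + rewrite CZ_add, <- Hm. unfold sum_h. destruct q; simpl; f_equal; apply CC_ext; simpl; ring.
    + simpl length. destruct q; lia.
Qed.

(** State weights are integers bounded by the number of sites, so every dynamical parameter is tau
    plus a bounded integer multiple of g. *)
Lemma regular_weight (tau : CC) (n : nat) (so : list bool) (k : Z) (z : CC) :
  regular tau n -> (Z.of_nat (length so) + Z.abs k <= Z.of_nat n)%Z ->
  z = tau - g * sum_h so + CZ k * g -> th z <> C0.
Proof.
  intros H Hn ->. destruct (sum_h_int so) as [m [Hm Hl]].
  replace (tau - g * sum_h so + CZ k * g) with (tau + CZ (- m + k) * g).
  - apply H; lia.
  - rewrite CZ_add, CZ_opp, Hm; ring.
Qed.

Lemma op_length (mus : list CC) (b : bool) (x tau : CC) (v : list bool -> CC) (so : list bool) :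
  length so <> length mus -> op mus b x tau v so = C0.
Proof.
  revert b v so; induction mus as [|mu mus IH]; intros b v [|q so] H; simpl in H; cbn [op];
    try reflexivity; [lia|].
  rewrite !IH by lia. ring.
Qed.

Definition exchange_relations (mus : list CC) (x1 x2 tau : CC) (v : list bool -> CC) (so : list bool) : Prop :=
  let t := tau - g * sum_h so in
  let BB y z := op mus true y tau (op mus true z (tau + g) v) so in
  let BD y z := op mus true y tau (op mus false z (tau + g) v) so in
  let DB y z := op mus false y tau (op mus true z (tau + g) v) so in
  let DD y z := op mus false y tau (op mus false z (tau + g) v) so in
  BB x1 x2 = BB x2 x1 /\ DD x1 x2 = DD x2 x1 /\
  th (t + g) * th (x1 - x2) * DB x1 x2
  = th (x1 - x2 + g) * th t * BD x2 x1 - th (t + (x1 - x2)) * th g * BD x1 x2.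

(* Proving the three relations together needs only [x1 - x2] as a denominator; deriving the
   symmetry of BB from the Yang-Baxter equation would also divide by [x1 - x2 + g]. *)
Lemma exchange (mus : list CC) (x1 x2 tau : CC) (v : list bool -> CC) (so : list bool) :
  th (x1 - x2) <> C0 -> length so = length mus -> regular tau (S (length mus)) ->
  exchange_relations mus x1 x2 tau v so.
Proof.
  assert (Hflip : forall y z, th (y - z) <> C0 -> th (z - y) <> C0).
  { intros y z H H'. apply H. rewrite (th_flip (z - y) (y - z)), H' by ring. ring. }
  revert x1 x2 v so; induction mus as [|mu mus IH]; intros x1 x2 v so Hx Hl Hreg.
  - destruct so; [|discriminate].
    unfold exchange_relations; simpl. repeat split; try ring.
  - destruct so as [|q so]; [discriminate|].
    simpl in Hl, Hreg. injection Hl as Hl.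
    assert (Hreg' : regular tau (S (length mus))) by (intros m Hm; apply Hreg; lia).
    unfold exchange_relations.
    set (t := tau - g * sum_h so).
    set (vt := fun s => v (true :: s)). set (vf := fun s => v (false :: s)).
    assert (Ht : th t <> C0).
    { apply (regular_weight tau _ so 0 _ Hreg); [lia|]. unfold t; change (CZ 0) with C0; ring. }
    assert (Htp : th (t + g) <> C0).
    { apply (regular_weight tau _ so 1 _ Hreg); [lia|]. unfold t; change (CZ 1) with C1; ring. }
    assert (Htm : th (t - g) <> C0).
    { apply (regular_weight tau _ so (-1) _ Hreg); [lia|]. unfold t; change (CZ (-1)) with (CZ (- (1))); rewrite CZ_opp; change (CZ 1) with C1; ring. }
    assert (Hxm : (x1 - mu) - (x2 - mu) = x1 - x2) by ring.
    assert (Hu : th ((x1 - mu) - (x2 - mu)) <> C0) by (rewrite Hxm; exact Hx).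
    destruct (IH x1 x2 vt so Hx Hl Hreg') as [BBt [DDt DB12t]].
    destruct (IH x1 x2 vf so Hx Hl Hreg') as [BBf [DDf DB12f]].
    destruct (IH x2 x1 vt so (Hflip _ _ Hx) Hl Hreg') as [_ [_ DB21t]].
    destruct (IH x2 x1 vf so (Hflip _ _ Hx) Hl Hreg') as [_ [_ DB21f]].
    fold t in DB12t, DB12f, DB21t, DB21f.
    (* Oddness turns the relation with x1 and x2 exchanged into one in x1 - x2, the form of
       [E21]. *)
    assert (Hsgn : forall DB BD BD' : CC,
      th (t + g) * th (x2 - x1) * DB = th (x2 - x1 + g) * th t * BD - th (t + (x2 - x1)) * th g * BD' ->
      th (t + g) * th ((x1 - mu) - (x2 - mu)) * DB = th ((x1 - mu) - (x2 - mu) - g) * th t * BD + th (t - ((x1 - mu) - (x2 - mu))) * th g * BD').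
    { intros DB BD BD' H. rewrite Hxm.
      rewrite (th_flip (x1 - x2) (x2 - x1)), (th_flip (x1 - x2 - g) (x2 - x1 + g)) in H by ring.
      replace (t + (x2 - x1)) with (t - (x1 - x2)) in H by ring.
      transitivity (- (th (t + g) * - th (x1 - x2) * DB)); [ring|]. rewrite H. ring. }
    rewrite <- Hxm in DB12t, DB12f.
    apply Hsgn in DB21t. apply Hsgn in DB21f.
    (* The inner parameter is t + g under an outer D and t - g under an outer B. *)
    assert (Tp : t + g = tau + g - g * (sum_h so + C1 + heig false)) by (unfold t; simpl; ring).
    assert (Tm : t - g = tau + g - g * (sum_h so + C1 + heig true)) by (unfold t; simpl; ring).
    destruct q.
    + replace (tau - g * sum_h (true :: so)) with (t - g) by (unfold t, sum_h; simpl; ring).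
      replace (t - g + g) with t by ring.
      split; [|split].
      * rewrite !op_Bt, !op_inner_Bt. fold vt. rewrite BBt. ring.
      * rewrite !op_Dt. fold t.
        rewrite !(op_inner_Dt _ _ _ _ _ _ _ _ _ Tp), !op_inner_Df. fold vt vf.
        rewrite DDt.
        (* The mixed terms agree by [DD_coef]; the pure D D term needs only the swap of the two b_-
           weights. *)
        pose proof (DD_coef _ _ _ Ht Htp Hu _ _ _ _ DB12f DB21f) as E.
        pose proof (wbm_swap (x1 - mu) (x2 - mu) t (t + g)) as S.
        apply CC_sub_zero.
        let e := diff E in let s := diff S in
        transitivity (e + s * op mus false x2 tau (op mus false x1 (tau + g) vt) so); [ring|].
        rewrite E, S; ring.
      * rewrite op_Dt, !op_Bt. fold t.
        rewrite op_inner_Bt, (op_inner_Bf _ _ _ _ _ _ _ _ _ Tm), !(op_inner_Dt _ _ _ _ _ _ _ _ _ Tm).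
        fold vt vf. rewrite <- BBf.
        pose proof (DB_coef_t _ _ _ Ht Htm _ _ _ DB12t (op mus true x1 tau (op mus true x2 (tau + g) vf) so)) as E.
        rewrite Hxm in E. exact E.
    + replace (tau - g * sum_h (false :: so)) with (t + g) by (unfold t, sum_h; simpl; ring).
      split; [|split].
      * rewrite !op_Bf. fold t.
        rewrite !(op_inner_Bf _ _ _ _ _ _ _ _ _ Tm), !op_inner_Bt. fold vt vf.
        rewrite BBf.
        pose proof (BB_coef _ _ _ Ht Htp Htm Hu _ _ _ _ DB12t DB21t) as E.
        pose proof (wbp_swap (x1 - mu) (x2 - mu) t (t - g)) as S.
        apply CC_sub_zero.
        let e := diff E in let s := diff S in
        transitivity (e + s * op mus true x2 tau (op mus true x1 (tau + g) vf) so); [ring|].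
        rewrite E, S; ring.
      * rewrite !op_Df, !op_inner_Df. fold vf. rewrite DDf. ring.
      * rewrite op_Df, !op_Bf. fold t.
        rewrite (op_inner_Bf _ _ _ _ _ _ _ _ _ Tp), !op_inner_Df, !(op_inner_Dt _ _ _ _ _ _ _ _ _ Tp).
        fold vt vf. rewrite <- DDt.
        pose proof (DB_coef_f _ _ _ Ht Htp Hu _ _ _ _ DB12f DB21f (op mus false x1 tau (op mus false x2 (tau + g) vt) so)) as E.
        rewrite Hxm in E. exact E.
Qed.

(** * Moving D through a product of B's *)

Lemma regular_le (tau : CC) (n n' : nat) : (n' <= n)%nat -> regular tau n -> regular tau n'.
Proof. intros Hn H m Hm. apply H. lia. Qed.

Lemma regular_shift (tau : CC) (n : nat) : regular tau (S n) -> regular (tau + g) n.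
Proof.
  intros H m Hm. replace (tau + g + CZ m * g) with (tau + CZ (1 + m) * g).
  - apply H; lia.
  - rewrite CZ_add; change (CZ 1) with C1; ring.
Qed.

Fixpoint Bs (mus : list CC) (tau : CC) (xs : list CC) (v : list bool -> CC) : list bool -> CC :=
  match xs with
  | nil => v
  | x :: xs' => op mus true x (tau + g) (Bs mus (tau + g) xs' v)
  end.

Lemma applyBs_Bs (mus : list CC) (tau tau' : CC) (k : nat) (xs : list CC) (v : list bool -> CC) :
  tau' + g = tau + Cnat k * g -> applyBs p g mus tau k xs v = Bs mus tau' xs v.
Proof.
  revert tau' k; induction xs as [|x xs IH]; intros tau' k H; [reflexivity|].
  cbn [applyBs Bs]. rewrite (IH (tau' + g) (S k)).
  - unfold applyB. apply functional_extensionality; intros so. rewrite op_mono, H. reflexivity.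
  - rewrite H. unfold Cnat, RtoC. rewrite S_INR. apply CC_ext; simpl; ring.
Qed.

Lemma th_sub_sym (y z : CC) : th (y - z) <> C0 -> th (z - y) <> C0.
Proof. intros H H'. apply H. rewrite (th_flip (z - y) (y - z)), H' by ring. ring. Qed.

Lemma Bs_swap_head (mus : list CC) (tau a b : CC) (xs : list CC) (v : list bool -> CC) :
  th (a - b) <> C0 -> regular (tau + g) (S (length mus)) ->
  Bs mus tau (a :: b :: xs) v = Bs mus tau (b :: a :: xs) v.
Proof.
  intros Hab Hreg. apply functional_extensionality; intros so. cbn [Bs].
  (* Equality as functions is needed to rewrite under further operators; on states of the wrong
     length both sides are zero. *)
  destruct (Nat.eq_dec (length so) (length mus)) as [Hl|Hl].
  - apply exchange; assumption.
  - rewrite !op_length by exact Hl. reflexivity.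
Qed.

Lemma Bs_move (mus : list CC) (tau b : CC) (l1 l2 : list CC) (v : list bool -> CC) :
  (forall y, In y l1 -> th (y - b) <> C0) -> regular tau (length l1 + S (length mus)) ->
  Bs mus tau (l1 ++ b :: l2) v = Bs mus tau (b :: l1 ++ l2) v.
Proof.
  revert tau; induction l1 as [|a l1 IH]; intros tau H Hreg; [reflexivity|].
  transitivity (Bs mus tau (a :: b :: l1 ++ l2) v).
  - cbn [Bs app]. rewrite (IH (tau + g)).
    + reflexivity.
    + intros y Hy; apply H; now right.
    + apply regular_shift; exact Hreg.
  - apply Bs_swap_head; [apply H; now left|].
    apply regular_shift. apply (regular_le _ (length (a :: l1) + S (length mus))); [simpl; lia|exact Hreg].
Qed.

(** Brings b next to a, exchanges the two at the head, and carries a back to the place of b. *)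
Lemma Bs_swap (mus : list CC) (tau a b : CC) (l1 l2 : list CC) (v : list bool -> CC) :
  th (a - b) <> C0 -> (forall y, In y l1 -> th (y - a) <> C0 /\ th (y - b) <> C0) ->
  regular tau (S (length l1 + S (length mus))) ->
  Bs mus tau (a :: l1 ++ b :: l2) v = Bs mus tau (b :: l1 ++ a :: l2) v.
Proof.
  intros Hab H Hreg. pose proof (regular_shift _ _ Hreg) as Hreg'.
  transitivity (Bs mus tau (a :: b :: l1 ++ l2) v).
  - cbn [Bs]. rewrite (Bs_move mus (tau + g) b); [reflexivity| |exact Hreg'].
    intros y Hy; exact (proj2 (H y Hy)).
  - rewrite Bs_swap_head; [|exact Hab|apply (regular_le _ (length l1 + S (length mus))); [lia|exact Hreg']].
    cbn [Bs]. rewrite (Bs_move mus (tau + g) a); [reflexivity| |exact Hreg'].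
    intros y Hy; exact (proj1 (H y Hy)).
Qed.

(** * D on the vacuum and on the dual vacuum *)

Definition vac (n : nat) : list bool -> CC :=
  fun s => if list_eqb s (repeat true n) then C1 else C0.

Lemma list_eqb_spec (s s' : list bool) : list_eqb s s' = true <-> s = s'.
Proof. unfold list_eqb; destruct (list_eq_dec bool_dec s s'); split; congruence. Qed.

Lemma list_eqb_cons (q q' : bool) (s s' : list bool) :
  list_eqb (q :: s) (q' :: s') = eqb q q' && list_eqb s s'.
Proof.
  apply eq_true_iff_eq. rewrite andb_true_iff, !list_eqb_spec, eqb_true_iff.
  split; [intros H; injection H; auto|intros [-> ->]; reflexivity].
Qed.

Definition Lam (mus : list CC) (y : CC) : CC := Cprod (map (fun mu => th (y - mu)) mus).

Lemma sum_h_repeat_true (n : nat) : sum_h (repeat true n) = CZ (Z.of_nat n).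
Proof.
  induction n as [|n IH]; [reflexivity|].
  rewrite Nat2Z.inj_succ, <- Z.add_1_l, CZ_add, <- IH. reflexivity.
Qed.

Lemma sum_h_repeat_false (n : nat) : sum_h (repeat false n) = CZ (- Z.of_nat n).
Proof.
  induction n as [|n IH]; [reflexivity|].
  replace (- Z.of_nat (S n))%Z with (- (1) + - Z.of_nat n)%Z by lia.
  rewrite CZ_add, <- IH, CZ_opp. reflexivity.
Qed.

(** On the vacuum only the b_- weights survive, with parameters tau, tau - g, ... from the last site
    to the first; the ratios [t + g] / [t] telescope to the quotient in front. *)
Lemma op_D_vac (mus : list CC) (x tau : CC) (so : list bool) :
  regular tau (S (length mus)) ->
  op mus false x tau (vac (length mus)) so
  = th (tau + g) / th (tau + g - CZ (Z.of_nat (length mus)) * g) * Lam mus x * vac (length mus) so.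
Proof.
  revert so; induction mus as [|mu mus IH]; intros so Hreg.
  - assert (Hn : th (tau + g - CZ 0 * g) <> C0).
    { replace (tau + g - CZ 0 * g) with (tau + CZ 1 * g) by (change (CZ 0) with C0; change (CZ 1) with C1; ring).
      apply Hreg; simpl; lia. }
    destruct so as [|q so]; cbn [op length Lam map Cprod fold_right].
    + replace (tau + g) with (tau + g - CZ 0 * g) at 1 by (change (CZ 0) with C0; ring).
      simpl. field. exact Hn.
    + unfold vac. simpl repeat. unfold list_eqb.
      destruct (list_eq_dec bool_dec (q :: so) nil); [discriminate|ring].
  - assert (Hreg' : regular tau (S (length mus))) by (apply (regular_le _ (S (S (length mus)))); [lia|exact Hreg]).
    destruct so as [|q so].
    { cbn [op]. unfold vac, list_eqb.
      destruct (list_eq_dec bool_dec nil (repeat true (length (mu :: mus)))); [discriminate|ring]. }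
    assert (Hv : forall q', (fun s => vac (length (mu :: mus)) (q' :: s)) = fun s => (if q' then C1 else C0) * vac (length mus) s).
    { intros q'; apply functional_extensionality; intros s. unfold vac. cbn [length repeat].
      rewrite list_eqb_cons. destruct q'; cbn [eqb andb]; destruct (list_eqb s (repeat true (length mus))); ring. }
    assert (Hz : vac (length (mu :: mus)) (q :: so) = (if q then C1 else C0) * vac (length mus) so)
      by exact (f_equal (fun f => f so) (Hv q)).
    rewrite Hz. destruct q.
    + rewrite op_Dt, !Hv, !op_scal, IH by exact Hreg'.
      (* Away from the all-v1 state both sides carry a zero factor; on it the weight of [so] is
         known and determines the denominators. *)
      assert (Hcase : vac (length mus) so = C0 \/ so = repeat true (length mus)).
      { unfold vac. destruct (list_eqb so (repeat true (length mus))) eqn:E; [right|now left].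
        apply list_eqb_spec; exact E. }
      destruct Hcase as [->|Hso]; [ring|].
      assert (Hs : tau - g * sum_h so = tau + g - CZ (Z.of_nat (length (mu :: mus))) * g).
      { rewrite Hso, sum_h_repeat_true. cbn [length]. rewrite Nat2Z.inj_succ, <- Z.add_1_l, CZ_add.
        change (CZ 1) with C1. ring. }
      unfold wbm. rewrite Hs.
      replace (tau + g - CZ (Z.of_nat (length (mu :: mus))) * g + g) with (tau + g - CZ (Z.of_nat (length mus)) * g).
      2:{ rewrite <- Hs, Hso, sum_h_repeat_true; ring. }
      change (Lam (mu :: mus) x) with (th (x - mu) * Lam mus x).
      field. split.
      * rewrite <- Hs, Hso, sum_h_repeat_true.
        replace (tau - g * CZ (Z.of_nat (length mus))) with (tau + CZ (- Z.of_nat (length mus)) * g).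
        -- apply Hreg'; lia.
        -- rewrite CZ_opp; ring.
      * replace (tau + g - CZ (Z.of_nat (length mus)) * g) with (tau + CZ (1 - Z.of_nat (length mus)) * g).
        -- apply Hreg'; lia.
        -- unfold Z.sub; rewrite CZ_add, CZ_opp; change (CZ 1) with C1; ring.
    + rewrite op_Df, !Hv, !op_scal. ring.
Qed.

(** With output v2 at a site, D passes to D on the remaining sites with the single weight a, which
    is independent of the dynamical parameter. *)
Lemma op_D_bottom (mus : list CC) (x tau : CC) (v : list bool -> CC) :
  op mus false x tau v (repeat false (length mus))
  = Cprod (map (fun mu => th (x - mu + g)) mus) * v (repeat false (length mus)).
Proof.
  revert v; induction mus as [|mu mus IH]; intros v; [simpl; ring|].
  cbn [length repeat map Cprod fold_right]. rewrite op_Df, IH. unfold wa, Cprod. ring.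
Qed.

Lemma op_sum {T} (mus : list CC) (b : bool) (x tau : CC) (c : T -> CC) (v : T -> list bool -> CC) (l : list T) (so : list bool) :
  op mus b x tau (fun s => Csum (map (fun i => c i * v i s) l)) so
  = Csum (map (fun i => c i * op mus b x tau (v i) so) l).
Proof.
  induction l as [|i l IH].
  - cbn [map Csum fold_right]. transitivity (op mus b x tau (fun s => C0 * C0) so); [f_equal; apply functional_extensionality; intros; ring|].
    rewrite op_scal; ring.
  - change (Csum (map (fun i => c i * op mus b x tau (v i) so) (i :: l)))
      with (c i * op mus b x tau (v i) so + Csum (map (fun i => c i * op mus b x tau (v i) so) l)).
    rewrite <- IH. transitivity (op mus b x tau (fun s => c i * v i s + C1 * Csum (map (fun i => c i * v i s) l)) so).
    + f_equal; apply functional_extensionality; intros; simpl; ring.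
    + rewrite op_lin; ring.
Qed.

(** * The action of D on a product of B's applied to the vacuum *)

Definition rr (z : CC) := th (z + g) / th z.
(** The factor of the terms in which x0 has entered a B; at T = tau + (L + 1) g and z = x0 - x_i it
    is the first factor of N_i. *)
Definition kap (T z : CC) := th g * th (T + z) / (th z * th T).

(** The left side collects the two contributions to D(y) that the induction hypothesis yields at T -
    g. The three-term relation with a = x0 - x1, b = x1 - y, c = g merges them into the coefficient
    at T and produces the new factor [rr (y - x1)]. *)
Lemma off_coef (x0 x1 y T : CC) :
  th T <> C0 -> th (T - g) <> C0 -> th (x0 - x1) <> C0 ->
  th (x0 - y) <> C0 -> th (x1 - y) <> C0 ->
  th (x0 - x1 + g) * th T * kap (T - g) (x0 - y) - th (T + (x0 - x1)) * th g * kap (T - g) (x1 - y)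
  = th (x0 - x1) * th T * kap T (x0 - y) * rr (y - x1).
Proof.
  intros HT HTm H01 H0y H1y.
  assert (W : th (x0 - x1 + g) * th (x1 - y) * th T * th (T - g + (x0 - y))
     - th g * th (x0 - y) * th (T + (x0 - x1)) * th (T - g + (x1 - y))
     - th (x0 - x1) * th (x1 - y - g) * th (T - g) * th (T + (x0 - y)) = C0)
    by (apply (three_term_at (x0 - x1) (x1 - y) g T); ring).
  unfold kap, rr.
  rewrite (th_flip (x1 - y) (y - x1)), (th_flip (x1 - y - g) (y - x1 + g)) by ring.
  apply (Cmul_cancel_l (th (x0 - y) * th (x1 - y) * th (T - g))); [auto using Cmul_neq0|].
  apply CC_sub_zero.
  let w := diff W in transitivity (th g * w).
  - field. repeat split; auto.
    intros H. apply H1y. transitivity (- (- th (x1 - y))); [ring|rewrite H; ring].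
  - rewrite W. ring.
Qed.

Lemma filter_neq_id (i a m : nat) : (i < a)%nat ->
  filter (fun j => negb (Nat.eqb j i)) (seq a m) = seq a m.
Proof.
  revert a; induction m as [|m IH]; intros a H; [reflexivity|].
  cbn [seq filter]. destruct (Nat.eqb_spec a i); [lia|]. cbn [negb]. rewrite IH by lia. reflexivity.
Qed.

Lemma replace_at_out (x : nat -> CC) (i a m : nat) (z : CC) : (i < a)%nat ->
  map (replace_at x i z) (seq a m) = map x (seq a m).
Proof.
  intros H. apply map_ext_in. intros j Hj. apply in_seq in Hj. unfold replace_at.
  destruct (Nat.eqb_spec j i); [lia|reflexivity].
Qed.

Lemma map_replace_at (x : nat -> CC) (i a m : nat) (z : CC) : (a <= i < a + m)%nat ->
  map (replace_at x i z) (seq a m)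
  = map x (seq a (i - a)) ++ z :: map x (seq (S i) (a + m - S i)).
Proof.
  intros H. replace m with ((i - a) + S (a + m - S i))%nat at 1 by lia.
  rewrite seq_app, map_app. cbn [seq map]. replace (a + (i - a))%nat with i by lia.
  f_equal; [|f_equal].
  - apply map_ext_in. intros j Hj. apply in_seq in Hj. unfold replace_at.
    destruct (Nat.eqb_spec j i); [lia|reflexivity].
  - unfold replace_at. rewrite Nat.eqb_refl. reflexivity.
  - apply replace_at_out; lia.
Qed.

(* Induction on the number of B's: D(x0) B(x1) splits into B(x1) D(x0) and B(x0) D(x1); the
   symmetry of the B's makes the two contributions containing D(xi), i > 1, proportional, and
   [off_coef] adds them up. *)
Lemma off_shell (mus : list CC) (m a : nat) (tau x0 : CC) (x : nat -> CC) (so : list bool) :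
  let L := length mus in
  let v := vac L in
  let T := tau + CZ (2 * Z.of_nat m - Z.of_nat L + 1) * g in
  (m <= L)%nat ->
  sum_h so = CZ (Z.of_nat L - 2 * Z.of_nat m) ->
  regular tau (L + 2 + m) ->
  (forall i, (a <= i < a + m)%nat -> th (x0 - x i) <> C0) ->
  (forall i j, (a <= i < a + m)%nat -> (a <= j < a + m)%nat -> i <> j -> th (x i - x j) <> C0) ->
  op mus false x0 (tau + g) (Bs mus (tau + g) (map x (seq a m)) v) so
  = th (tau + CZ (Z.of_nat m + 2) * g) / th (T + g) *
    (Lam mus x0 * Cprod (map (fun j => rr (x0 - x j)) (seq a m)) * Bs mus tau (map x (seq a m)) v so
     - Csum (map (fun i => kap T (x0 - x i) *
          (Lam mus (x i) * Cprod (map (fun j => rr (x i - x j))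
               (filter (fun j => negb (Nat.eqb j i)) (seq a m)))
           * Bs mus tau (map (replace_at x i x0) (seq a m)) v so)) (seq a m))).
Proof.
  (* All four are generalised: the hypothesis is used at a + 1 and tau + g, on intermediate states,
     and with [x1] as well as [x0] as the argument of D. *)
  intros L v; revert a tau x0 so; induction m as [|m IH]; intros a tau x0 so T Hm Hso Hreg Hx0 Hxx.
  - cbn [seq map Bs Cprod Csum fold_right]. unfold v, L.
    rewrite op_D_vac.
    2:{ apply regular_shift. apply (regular_le _ (L + 2 + 0)); [unfold L; lia|exact Hreg]. }
    assert (HT : T + g = tau + g + g - CZ (Z.of_nat (length mus)) * g).
    { unfold T, L. change (2 * Z.of_nat 0 - Z.of_nat (length mus) + 1)%Z with (- Z.of_nat (length mus) + 1)%Z.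
      rewrite CZ_add, CZ_opp; change (CZ 1) with C1; ring. }
    rewrite HT.
    replace (tau + CZ (Z.of_nat 0 + 2) * g) with (tau + g + g).
    2:{ change (Z.of_nat 0 + 2)%Z with (1 + 1)%Z. rewrite CZ_add; change (CZ 1) with C1; ring. }
    unfold Cdiv; ring.
  - set (x1 := x a). set (rest := map x (seq (S a) m)).
    assert (Hreg' : regular (tau + g) (L + 2 + m)).
    { apply regular_shift. apply (regular_le _ (L + 2 + S m)); [lia|exact Hreg]. }
    assert (Hx01 : th (x0 - x1) <> C0) by (apply Hx0; lia).
    (* T is the dynamical parameter of the exchange relation at tau + g, evaluated through the
       weight L - 2 m of the state. *)
    assert (HTh : T = tau + g - g * sum_h so).
    { rewrite Hso. unfold T.
      replace (2 * Z.of_nat (S m) - Z.of_nat L + 1)%Z with (1 + - (Z.of_nat L - 2 * Z.of_nat (S m)))%Z by lia.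
      rewrite CZ_add, CZ_opp; change (CZ 1) with C1; ring. }
    assert (HT1 : th T <> C0) by (apply Hreg; lia).
    assert (HTp : th (T + g) <> C0).
    { replace (T + g) with (tau + CZ (2 * Z.of_nat (S m) - Z.of_nat L + 1 + 1) * g).
      - apply Hreg; lia.
      - rewrite CZ_add. unfold T; change (CZ 1) with C1; ring. }
    assert (HTm' : T - g = tau + g + CZ (2 * Z.of_nat m - Z.of_nat L + 1) * g).
    { unfold T. replace (2 * Z.of_nat (S m) - Z.of_nat L + 1)%Z with (1 + (1 + (2 * Z.of_nat m - Z.of_nat L + 1)))%Z by lia.
      rewrite !(CZ_add 1); change (CZ 1) with C1; ring. }
    assert (HTm : th (T - g) <> C0) by (rewrite HTm'; apply Hreg'; lia).
    assert (Hex : th (T + g) * th (x0 - x1) * op mus false x0 (tau + g) (Bs mus (tau + g) (x1 :: rest) v) so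
       = th (x0 - x1 + g) * th T * op mus true x1 (tau + g) (op mus false x0 (tau + g + g) (Bs mus (tau + g + g) rest v)) so
         - th (T + (x0 - x1)) * th g * op mus true x0 (tau + g) (op mus false x1 (tau + g + g) (Bs mus (tau + g + g) rest v)) so).
    { rewrite HTh. destruct (Nat.eq_dec (length so) (length mus)) as [Hl|Hl].
      - apply exchange; [exact Hx01|exact Hl|].
        apply (regular_le _ (L + 2 + m)); [unfold L; lia|exact Hreg'].
      - rewrite !op_length by exact Hl. ring. }
    (* The numerator is constant along the induction, as tau gains g when one B is removed. The
       denominator telescopes through the factors th T / th (T + g) of the exchange relation,
       starting from the vacuum eigenvalue. *)
    set (rho := th (tau + CZ (Z.of_nat (S m) + 2) * g)).
    set (P := fun i => Lam mus (x i) * Cprod (map (fun j => rr (x i - x j))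
               (filter (fun j => negb (Nat.eqb j i)) (seq (S a) m)))).
    (* The induction hypothesis covers states of weight L - 2 m only; these are the intermediate
       states that the ice rule admits below B(y). *)
    assert (Hstep : forall y z, (forall i, (S a <= i < S a + m)%nat -> th (z - x i) <> C0) ->
       op mus true y (tau + g) (op mus false z (tau + g + g) (Bs mus (tau + g + g) rest v)) so
       = rho / th T * (Lam mus z * Cprod (map (fun j => rr (z - x j)) (seq (S a) m)) * Bs mus tau (y :: rest) v so
          - Csum (map (fun i => kap (T - g) (z - x i) * (P i * Bs mus tau (y :: map (replace_at x i z) (seq (S a) m)) v so))
               (seq (S a) m)))).
    { intros y z Hz.
      set (F := fun s => Csum (map (fun i => kap (T - g) (z - x i) * P i * Bs mus (tau + g) (map (replace_at x i z) (seq (S a) m)) v s) (seq (S a) m))).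
      transitivity (op mus true y (tau + g) (fun s => rho / th T * (Lam mus z * Cprod (map (fun j => rr (z - x j)) (seq (S a) m))) * Bs mus (tau + g) rest v s
          + (- (rho / th T)) * F s) so).
      - apply op_ext. intros s Hl Hs. unfold rest.
        rewrite (IH (S a) (tau + g) z s).
        + rewrite <- HTm'.
          replace (T - g + g) with T by ring.
          replace (tau + g + CZ (Z.of_nat m + 2) * g) with (tau + CZ (Z.of_nat (S m) + 2) * g).
          2:{ replace (Z.of_nat (S m) + 2)%Z with (1 + (Z.of_nat m + 2))%Z by lia.
              rewrite (CZ_add 1); change (CZ 1) with C1; ring. }
          fold rho.
          replace (F s) with (Csum (map (fun i => kap (T - g) (z - x i) * (P i * Bs mus (tau + g) (map (replace_at x i z) (seq (S a) m)) v s)) (seq (S a) m))).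
          2:{ unfold F. apply Csum_ext; intros; ring. }
          unfold P. ring.
        + lia.
        + rewrite Hs, Hso.
          replace (Z.of_nat L - 2 * Z.of_nat m)%Z with (Z.of_nat L - 2 * Z.of_nat (S m) + 1 + 1)%Z by lia.
          rewrite !CZ_add. reflexivity.
        + exact Hreg'.
        + intros i Hi. apply Hz. lia.
        + intros i j Hi Hj. apply Hxx; lia.
      - rewrite op_lin. unfold F.
        rewrite (op_sum mus true y (tau + g) (fun i => kap (T - g) (z - x i) * P i)
          (fun i => Bs mus (tau + g) (map (replace_at x i z) (seq (S a) m)) v)).
        cbn [Bs].
        replace (Csum (map (fun i => kap (T - g) (z - x i) * P i * op mus true y (tau + g) (Bs mus (tau + g) (map (replace_at x i z) (seq (S a) m)) v) so) (seq (S a) m)))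
          with (Csum (map (fun i => kap (T - g) (z - x i) * (P i * op mus true y (tau + g) (Bs mus (tau + g) (map (replace_at x i z) (seq (S a) m)) v) so)) (seq (S a) m))).
        2:{ apply Csum_ext; intros; ring. }
        ring. }
    rewrite (Hstep x1 x0), (Hstep x0 x1) in Hex.
    2:{ intros i Hi; apply Hxx; lia. }
    2:{ intros i Hi; apply Hx0; lia. }
    set (Q := fun i => P i * Bs mus tau (x1 :: map (replace_at x i x0) (seq (S a) m)) v so).
    (* Exchanging [x0] at the head with [x1] at position i makes both sums run over the same vectors
       [Q i]. *)
    assert (HQ : Csum (map (fun i => kap (T - g) (x1 - x i) * (P i * Bs mus tau (x0 :: map (replace_at x i x1) (seq (S a) m)) v so)) (seq (S a) m))
       = Csum (map (fun i => kap (T - g) (x1 - x i) * Q i) (seq (S a) m))).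
    { apply Csum_ext. intros i Hi. apply in_seq in Hi. unfold Q.
      rewrite !map_replace_at by lia.
      rewrite Bs_swap; [reflexivity|exact Hx01| |].
      - intros y Hy. apply in_map_iff in Hy. destruct Hy as [j [<- Hj]]. apply in_seq in Hj.
        split; [apply th_sub_sym, Hx0; lia|apply Hxx; lia].
      - rewrite length_map, length_seq. apply (regular_le _ (L + 2 + S m)); [unfold L; lia|exact Hreg]. }
    rewrite HQ in Hex. clear HQ.
    change (map (fun i => kap (T - g) (x0 - x i) * (P i * Bs mus tau (x1 :: map (replace_at x i x0) (seq (S a) m)) v so)) (seq (S a) m))
      with (map (fun i => kap (T - g) (x0 - x i) * Q i) (seq (S a) m)) in Hex.
    assert (Hcomb : th (x0 - x1 + g) * th T * Csum (map (fun i => kap (T - g) (x0 - x i) * Q i) (seq (S a) m))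
        - th (T + (x0 - x1)) * th g * Csum (map (fun i => kap (T - g) (x1 - x i) * Q i) (seq (S a) m))
      = th (x0 - x1) * th T * Csum (map (fun i => kap T (x0 - x i) * rr (x i - x1) * Q i) (seq (S a) m))).
    { transitivity (Csum (map (fun i => th (x0 - x1 + g) * th T * (kap (T - g) (x0 - x i) * Q i)
          + (- (th (T + (x0 - x1)) * th g)) * (kap (T - g) (x1 - x i) * Q i)) (seq (S a) m))).
      { rewrite Csum_lin; ring. }
      transitivity (Csum (map (fun i => th (x0 - x1) * th T * (kap T (x0 - x i) * rr (x i - x1) * Q i) + C0 * C0) (seq (S a) m))).
      2:{ rewrite Csum_lin; ring. }
      apply Csum_ext. intros i Hi. apply in_seq in Hi.
      pose proof (off_coef x0 x1 (x i) T HT1 HTm Hx01 (Hx0 i ltac:(lia)) (Hxx a i ltac:(lia) ltac:(lia) ltac:(lia))) as E.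
      transitivity ((th (x0 - x1 + g) * th T * kap (T - g) (x0 - x i) - th (T + (x0 - x1)) * th g * kap (T - g) (x1 - x i)) * Q i); [ring|].
      rewrite E. ring. }
    assert (Hsum : Csum (map (fun i => kap T (x0 - x i) *
          (Lam mus (x i) * Cprod (map (fun j => rr (x i - x j))
               (filter (fun j => negb (Nat.eqb j i)) (seq a (S m))))
           * Bs mus tau (map (replace_at x i x0) (seq a (S m))) v so)) (seq a (S m)))
       = kap T (x0 - x1) * (Lam mus x1 * Cprod (map (fun j => rr (x1 - x j)) (seq (S a) m)) * Bs mus tau (x0 :: rest) v so)
         + Csum (map (fun i => kap T (x0 - x i) * rr (x i - x1) * Q i) (seq (S a) m))).
    { cbn [seq map].
      match goal with |- Csum (?z :: ?l) = _ => change (Csum (z :: l)) with (z + Csum l) end.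
      f_equal.
      - cbn [filter]. rewrite Nat.eqb_refl. cbn [negb]. rewrite filter_neq_id, replace_at_out by lia.
        unfold replace_at. rewrite Nat.eqb_refl. reflexivity.
      - apply Csum_ext. intros i Hi. apply in_seq in Hi.
        cbn [filter]. destruct (Nat.eqb_spec a i); [lia|]. cbn [negb map].
        replace (replace_at x i x0 a) with x1.
        2:{ unfold replace_at. destruct (Nat.eqb_spec a i); [lia|reflexivity]. }
        unfold Q, P, x1. cbn [Cprod fold_right]. unfold Cprod. ring. }
    rewrite Hsum. clear Hsum.
    change (map x (seq a (S m))) with (x1 :: rest).
    change (Cprod (map (fun j => rr (x0 - x j)) (seq a (S m))))
      with (rr (x0 - x1) * Cprod (map (fun j => rr (x0 - x j)) (seq (S a) m))).
    fold rho.
    apply (Cmul_cancel_l (th (T + g) * th (x0 - x1))); [auto using Cmul_neq0|].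
    rewrite Hex. apply CC_sub_zero.
    (* The wanted term and the term i = a match directly through [rr (x0 - x1)] and
       [kap T (x0 - x1)]; what is left is a multiple of [Hcomb]. *)
    let e := diff Hcomb in transitivity (- (rho / th T) * e).
    + unfold kap, rr. field. auto.
    + rewrite Hcomb; ring.
Qed.

End Algebra.

Theorem theorem3p2 (p : R) (g : CC) (L : nat) (mu : nat -> CC)
  (tau x0 : CC) (x : nat -> CC) :
  0 < p < 1 -> (1 <= L)%nat ->
  (* genericity: every denominator occurring below is nonzero *)
  (forall m : Z, (Z.abs m <= 2 * Z.of_nat L + 2)%Z ->
       theta p (Cadd tau (Cmul (CZ m) g)) <> C0) ->
  (forall i : nat, (1 <= i <= L)%nat -> theta p (Csub x0 (x i)) <> C0) ->
  (forall i j : nat, (1 <= i <= L)%nat -> (1 <= j <= L)%nat -> i <> j ->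
       theta p (Csub (x i) (x j)) <> C0) ->
  Cadd (Cadd (Cmul (M0D p g L mu x0) (Zpart p g L mu (Cadd tau g) x))
             (Cmul (N0D p g L mu x0 x) (Zpart p g L mu tau x)))
       (Csum (map (fun i => Cmul (NiD p g L mu tau x0 x i)
                                 (Zpart p g L mu tau (replace_at x i x0)))
                  (seq 1 L)))
  = C0.
Proof.
  intros Hp HL Hreg Hx0 Hxx.
  set (mus := map mu (seq 1 L)).
  assert (Hlen : length mus = L) by (unfold mus; rewrite length_map, length_seq; reflexivity).
  assert (HZ : forall tau' y, Zpart p g L mu tau' y
      = Bs p g mus tau' (map y (seq 1 L)) (vac L) (repeat false L)).
  { intros tau' y. unfold Zpart. rewrite (applyBs_Bs p g mus tau' tau' 1); [reflexivity|].
    change (Cnat 1) with C1. ring. }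
  assert (Hreg' : regular p g tau (L + 2 + L)) by (intros m Hm; apply Hreg; lia).
  pose proof (op_D_bottom p g mus x0 (tau + g) (Bs p g mus (tau + g) (map x (seq 1 L)) (vac L))) as HD.
  pose proof (off_shell p g Hp mus L 1 tau x0 x (repeat false L)) as H.
  cbv zeta in H. rewrite Hlen in HD, H. rewrite HD in H. clear HD.
  specialize (H (le_n L)).
  assert (HT : tau + CZ (2 * Z.of_nat L - Z.of_nat L + 1) * g = tau + Cnat (L + 1) * g).
  { unfold Cnat. rewrite INR_IZR_INZ. replace (Z.of_nat (L + 1)) with (2 * Z.of_nat L - Z.of_nat L + 1)%Z by lia. reflexivity. }
  (* For m = L numerator and denominator of the prefactor in [off_shell] have the same argument tau
     + (L + 2) g, so the prefactor is 1. *)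
  assert (HT' : tau + CZ (Z.of_nat L + 2) * g = tau + CZ (2 * Z.of_nat L - Z.of_nat L + 1) * g + g).
  { replace (Z.of_nat L + 2)%Z with (2 * Z.of_nat L - Z.of_nat L + 1 + 1)%Z by lia.
    rewrite CZ_add. change (CZ 1) with C1. ring. }
  assert (Hne : theta p (tau + CZ (2 * Z.of_nat L - Z.of_nat L + 1) * g + g) <> C0).
  { rewrite <- HT'. apply Hreg. lia. }
  rewrite HT', HT in H. rewrite HT in Hne.
  assert (Hso : sum_h (repeat false L) = CZ (Z.of_nat L - 2 * Z.of_nat L)).
  { rewrite sum_h_repeat_false. f_equal. lia. }
  specialize (H Hso Hreg').
  assert (HM : M0D p g L mu x0 * Zpart p g L mu (tau + g) x
     = - (N0D p g L mu x0 x * Zpart p g L mu tau x)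
       - Csum (map (fun i => NiD p g L mu tau x0 x i * Zpart p g L mu tau (replace_at x i x0)) (seq 1 L))).
  { rewrite !HZ.
    replace (M0D p g L mu x0) with (Cprod (map (fun mu0 => theta p (x0 - mu0 + g)) mus))
      by (unfold M0D, mus; rewrite map_map; reflexivity).
    rewrite H.
    2:{ intros i Hi. apply Hx0. lia. }
    2:{ intros i j Hi Hj. apply Hxx; lia. }
    rewrite (Csum_ext (fun i => NiD p g L mu tau x0 x i * Zpart p g L mu tau (replace_at x i x0))
       (fun i => kap p g (tau + Cnat (L + 1) * g) (x0 - x i) *
          (Lam p mus (x i) * Cprod (map (fun j => rr p g (x i - x j))
               (filter (fun j => negb (Nat.eqb j i)) (seq 1 L)))
           * Bs p g mus tau (map (replace_at x i x0) (seq 1 L)) (vac L) (repeat false L)))).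
    - replace (N0D p g L mu x0 x) with (- (Lam p mus x0 * Cprod (map (fun j => rr p g (x0 - x j)) (seq 1 L)))).
      + field. exact Hne.
      + unfold N0D, Lam, mus, rr. rewrite map_map. reflexivity.
    - intros i _. rewrite HZ. unfold NiD, kap, Lam, rr, mus. rewrite map_map. cbv zeta. ring. }
  rewrite HM. ring.
Qed.
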